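(* For a partition $\lambda$ of $n\ge1$, the Hall inner product $\langle Q_\lambda(x;-1),p_n \rangle$ is nonzero if and only if $n$ is odd and $2>\ell(\lambda)-1$. In particular, for any graded partition sequence $\{\lambda^n\}_{n\ge0}$ with $u_n=Q_{\lambda^n}(x;-1)$, the set $\{u_n\}_{n\geq0}$ is algebraically dependent.
   Context: $p_n$ is the $n$th power sum and the Hall inner product satisfies $\langle h_\lambda,m_\mu\rangle=\delta_{\lambda\mu}$. $P_\lambda(x;t)$ is the Hall–Littlewood symmetric function (inverse limit of $P_\lambda(x_1,\dots,x_N;t)=\frac{1}{v_\lambda(t)}\sum_{w\in S_N} w\big(x^{\lambda}\prod_{i<j}\frac{x_i-tx_j}{x_i-x_j}\big)$, $v_\lambda(t)=\prod_{i\ge0}\prod_{j=1}^{m_i}\frac{1-t^j}{1-t}$), $Q_\lambda(x;t)=\big(\prod_{i\ge1}\prod_{j=1}^{m_i(\lambda)}(1-t^j)\big)P_\lambda(x;t)$ with $m_i(\lambda)$ the number of parts equal to $i$, and $Q_\lambda(x;-1)$ (Schur's $Q$-function) is the specialization at $t=-1$. $\ell(\lambda)$ is the number of nonzero parts. Coefficients are taken in a field of characteristic $0$. A graded partition sequence has $\lambda^n\vdash n$. *)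

(* Defs.v *)
From HB Require Import structures.
From mathcomp Require Import all_boot all_order all_algebra all_fingroup.
From mathcomp Require Import boolp classical_sets mpoly.

Set Implicit Arguments.
Unset Strict Implicit.
Unset Printing Implicit Defensive.

Import GRing.Theory.

Local Open Scope ring_scope.

(* [symfun R] is the inverse limit, in the category of graded [R]-algebras, of
   the rings of symmetric polynomials in [N] variables along the maps setting
   the last variable to [0]; inverse limits of graded rings only contain the
   coherent sequences of bounded degree. *)

Definition polyfam (R : comNzRingType) := forall N : nat, {mpoly R[N]}.

Section PolyFam.
Variable R : comNzRingType.
Implicit Types f g h : polyfam R.

HB.instance Definition _ := gen_eqMixin (polyfam R).
HB.instance Definition _ := gen_choiceMixin (polyfam R).

Definition pf_zero : polyfam R := fun N => 0.
Definition pf_one : polyfam R := fun N => 1.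
Definition pf_opp f : polyfam R := fun N => - f N.
Definition pf_add f g : polyfam R := fun N => f N + g N.
Definition pf_mul f g : polyfam R := fun N => f N * g N.
Definition pf_scale (c : R) f : polyfam R := fun N => c *: f N.

Let pf_ext f g : (forall N, f N = g N) -> f = g.
Proof. exact: functional_extensionality_dep. Qed.

Fact pf_addA : associative pf_add.
Proof. by move=> f g h; apply: pf_ext => N; apply: addrA. Qed.
Fact pf_addC : commutative pf_add.
Proof. by move=> f g; apply: pf_ext => N; apply: addrC. Qed.
Fact pf_add0 : left_id pf_zero pf_add.
Proof. by move=> f; apply: pf_ext => N; apply: add0r. Qed.
Fact pf_addN : left_inverse pf_zero pf_opp pf_add.
Proof. by move=> f; apply: pf_ext => N; apply: addNr. Qed.

HB.instance Definition _ :=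
  GRing.isZmodule.Build (polyfam R) pf_addA pf_addC pf_add0 pf_addN.

Fact pf_mulA : associative pf_mul.
Proof. by move=> f g h; apply: pf_ext => N; apply: mulrA. Qed.
Fact pf_mulC : commutative pf_mul.
Proof. by move=> f g; apply: pf_ext => N; apply: mulrC. Qed.
Fact pf_mul1 : left_id pf_one pf_mul.
Proof. by move=> f; apply: pf_ext => N; apply: mul1r. Qed.
Fact pf_mulDl : left_distributive pf_mul pf_add.
Proof. by move=> f g h; apply: pf_ext => N; apply: mulrDl. Qed.
Fact pf_one_neq0 : pf_one != pf_zero.
Proof.
apply/eqP => /(congr1 (fun f : polyfam R => f 0%N)) /eqP.
by rewrite /pf_one /pf_zero oner_eq0.
Qed.

HB.instance Definition _ := GRing.Zmodule_isComNzRing.Build (polyfam R)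
  pf_mulA pf_mulC pf_mul1 pf_mulDl pf_one_neq0.

Fact pf_scaleA a b f : pf_scale a (pf_scale b f) = pf_scale (a * b) f.
Proof. by apply: pf_ext => N; apply: scalerA. Qed.
Fact pf_scale1 : left_id 1 pf_scale.
Proof. by move=> f; apply: pf_ext => N; apply: scale1r. Qed.
Fact pf_scaleDr : right_distributive pf_scale +%R.
Proof. by move=> a f g; apply: pf_ext => N; apply: scalerDr. Qed.
Fact pf_scaleDl f : {morph pf_scale^~ f : a b / a + b}.
Proof. by move=> a b; apply: pf_ext => N; apply: scalerDl. Qed.

HB.instance Definition _ := GRing.Zmodule_isLmodule.Build R (polyfam R)
  pf_scaleA pf_scale1 pf_scaleDr pf_scaleDl.

Fact pf_scaleAl (a : R) f g : a *: (f * g) = a *: f * g.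
Proof. by apply: pf_ext => N; apply: scalerAl. Qed.

HB.instance Definition _ :=
  GRing.Lmodule_isLalgebra.Build R (polyfam R) pf_scaleAl.

Fact pf_scaleAr (a : R) f g : a *: (f * g) = f * (a *: g).
Proof. by apply: pf_ext => N; apply: scalerAr. Qed.

HB.instance Definition _ :=
  GRing.Lalgebra_isAlgebra.Build R (polyfam R) pf_scaleAr.

Lemma pf0E N : (0 : polyfam R) N = 0. Proof. by []. Qed.
Lemma pf1E N : (1 : polyfam R) N = 1. Proof. by []. Qed.
Lemma pfNE f N : (- f) N = - f N. Proof. by []. Qed.
Lemma pfDE f g N : (f + g) N = f N + g N. Proof. by []. Qed.
Lemma pfME f g N : (f * g) N = f N * g N. Proof. by []. Qed.
Lemma pfZE c f N : (c *: f) N = c *: f N. Proof. by []. Qed.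

End PolyFam.

Definition last_zero (R : comNzRingType) (N : nat) (p : {mpoly R[N.+1]}) :
    {mpoly R[N]} :=
  p \mPo [tuple oapp (fun j => 'X_j) 0 (unlift ord_max i) | i < N.+1].

Definition is_symfun (R : comNzRingType) (f : polyfam R) : Prop :=
  [/\ forall N, f N \is symmetric,
      forall N, last_zero (f N.+1) = f N
    & exists d : nat, forall N, (msize (f N) <= d)%N].

Definition symfun_pred (R : comNzRingType) : pred (polyfam R) :=
  fun f => `[< is_symfun f >].

Section SymFun.
Variable R : comNzRingType.

Lemma symfunP (f : polyfam R) :
  reflect (is_symfun f) (f \in @symfun_pred R).
Proof. exact: asboolP. Qed.

Fact symfun_subalg_closed : subalg_closed (@symfun_pred R).
Proof.
split=> [|c f g /symfunP[sf lf [a da]] /symfunP[sg lg [b db]]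
         |f g /symfunP[sf lf [a da]] /symfunP[sg lg [b db]]]; apply/symfunP.
- split=> [N|N|]; first exact: rpred1.
    exact: comp_mpoly1.
  by exists 1%N => N; rewrite pf1E msize1.
- split=> [N|N|]; rewrite ?pfDE ?pfZE.
  + by apply: rpredD (sg N); apply: rpredZ (sf N).
  + rewrite /last_zero comp_mpolyD comp_mpolyZ.
    by congr (_ *: _ + _); [apply: lf | apply: lg].
  + exists (maxn a b) => N; rewrite pfDE pfZE.
    apply: leq_trans (msizeD_le _ _) _; rewrite geq_max !leq_max db orbT andbT.
    by rewrite (leq_trans (msizeZ_le _ _) (da N)).
- split=> [N|N|]; rewrite ?pfME.
  + by apply: rpredM (sg N); apply: sf.
  + rewrite /last_zero rmorphM /=.
    by congr (_ * _); [apply: lf | apply: lg].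
  + exists (a + b).+1 => N; rewrite pfME.
    by apply: leq_trans (msizeM_le _ _) _; rewrite ltnS leq_add.
Qed.

HB.instance Definition _ := GRing.isSubalgClosed.Build R (polyfam R)
  (@symfun_pred R) symfun_subalg_closed.

Record symfun := SymFun {
  symfun_val : polyfam R;
  _ : symfun_val \in @symfun_pred R }.

HB.instance Definition _ := [isSub for symfun_val].
HB.instance Definition _ := [Choice of symfun by <:].
HB.instance Definition _ := [SubChoice_isSubComNzRing of symfun by <:].
HB.instance Definition _ := [SubZmodule_isSubLmodule of symfun by <:].
HB.instance Definition _ := [SubNzRing_SubLmodule_isSubLalgebra of symfun by <:].
HB.instance Definition _ := [SubLalgebra_isSubAlgebra of symfun by <:].

Definition symfun_at (f : symfun) (N : nat) : {mpoly R[N]} := symfun_val f N.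

Lemma symfun_is (f : symfun) : is_symfun (symfun_val f).
Proof. by apply/symfunP/(valP f). Qed.

End SymFun.

Coercion symfun_at : symfun >-> Funclass.

Section Coefficients.
Variable R : comNzRingType.

Lemma mcoeff_last_zero N (p : {mpoly R[N.+1]}) m :
  (last_zero p)@_m = p@_(mnmwiden m).
Proof.
rewrite /last_zero comp_mpolyEX raddf_sum /= [in RHS](mpolyE p) raddf_sum /=.
apply: eq_bigr => k _; rewrite !mcoeffZ; congr (_ * _).
rewrite comp_mpolyX mcoeffX big_ord_recr /= tnth_mktuple unlift_none /=.
under eq_bigr => i _.
  rewrite tnth_mktuple.
  have -> : widen_ord (leqnSn N) i = lift ord_max i.
    by apply: val_inj; rewrite /= /bump leqNgt ltn_ord.
  by rewrite liftK /=; over.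
have [k0|kn0] := eqVneq (k ord_max) 0%N; last first.
  rewrite expr0n (negPf kn0) mulr0 mcoeff0.
  case: eqP => // kE; case/eqP: kn0; by rewrite kE mnmwiden_ordmax.
rewrite k0 expr0 mulr1 mprodXnE mcoeffX; congr (_ %:R); congr (nat_of_bool _).
apply/eqP/eqP => [<-|->].
  apply/mnmP => i; case: (unliftP ord_max i) => [j ->|->]; last first.
    by rewrite k0 mnmwiden_ordmax.
  have {2}-> : lift ord_max j = widen_ord (leqnSn N) j.
    by apply: val_inj; rewrite /= /bump leqNgt ltn_ord.
  rewrite mnmwiden_widen mnm_sumE (bigD1 j) //= big1 => [|l lj].
    by rewrite mulmnE mnmE eqxx mul1n addn0.
  by rewrite mulmnE mnmE (negPf lj) mul0n.
apply/mnmP => i; rewrite mnm_sumE (bigD1 i) //= big1 => [|l lj].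
  rewrite mulmnE mnmE eqxx mul1n addn0.
  have -> : lift ord_max i = widen_ord (leqnSn N) i.
    by apply: val_inj; rewrite /= /bump leqNgt ltn_ord.
  exact: mnmwiden_widen.
by rewrite mulmnE mnmE (negPf lj) mul0n.
Qed.

Lemma msize_leP N (p : {mpoly R[N]}) d :
  (forall m, (d <= mdeg m)%N -> p@_m = 0) -> (msize p <= d)%N.
Proof.
move=> p0; rewrite msizeE; apply/bigmax_leqP_seq => m + _.
rewrite mcoeff_msupp ltnNge; apply: contra => dm.
by rewrite p0.
Qed.

Lemma mcoeff_msize N (p : {mpoly R[N]}) m :
  (msize p <= mdeg m)%N -> p@_m = 0.
Proof. by move=> /msize_mdeg_ge /memN_msupp_eq0. Qed.

End Coefficients.

Section Map.
Variables (R S : comNzRingType) (phi : {rmorphism R -> S}).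

Fact symfun_map_subproof (f : symfun R) :
  (fun N => map_mpoly phi (f N) : {mpoly S[N]}) \in @symfun_pred S.
Proof.
have [sf lf [d df]] := symfun_is f; apply/symfunP; split=> [N|N|].
- apply/issymP => s; apply/mpolyP => m.
  by rewrite mcoeff_sym !mcoeff_map_mpoly -mcoeff_sym (issymP _ (sf N)).
- apply/mpolyP => m.
  by rewrite mcoeff_last_zero !mcoeff_map_mpoly /symfun_at -(lf N) mcoeff_last_zero.
- exists d => N; apply: msize_leP => m dm; rewrite mcoeff_map_mpoly.
  have fm : (msize (f N) <= mdeg m)%N := leq_trans (df N) dm.
  by rewrite (mcoeff_msize fm) raddf0.
Qed.

Definition symfun_map (f : symfun R) : symfun S :=
  SymFun (symfun_map_subproof f).

End Map.

Definition is_part (la : seq nat) : bool := sorted geq la && (0%N \notin la).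

Definition is_part_of (n : nat) (la : seq nat) : bool :=
  is_part la && (sumn la == n).

Section Bases.
Variable R : comNzRingType.

(* Below, the default value [0] is only used for [psum 0]: see [psumE], [hsumE] and [msumE]. *)
Definition to_symfun (f : polyfam R) : symfun R := insubd 0 f.

Lemma to_symfunE (f : polyfam R) N : is_symfun f -> to_symfun f N = f N.
Proof. by move=> /symfunP fP; rewrite /to_symfun /insubd insubT. Qed.

Definition psum (n : nat) : symfun R :=
  to_symfun (fun N => \sum_(i < N) 'X_i ^+ n).

Definition hsum (n : nat) : symfun R :=
  to_symfun (fun N => \sum_(m : 'X_{1..N < n.+1} | mdeg m == n) 'X_[m]).

Definition hsum_part (la : seq nat) : symfun R := \prod_(k <- la) hsum k.

(* The sum of the distinct monomials whose nonzero exponents are, up to order,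
   the parts of [la]. *)
Definition msum (la : seq nat) : symfun R :=
  to_symfun (fun N => \sum_(m : 'X_{1..N < (sumn la).+1} |
                            perm_eq [seq k <- m : seq nat | k != 0%N] la)
                         'X_[m]).

Let mnmwidenMn N (m : 'X_{1..N}) k :
  mnmwiden (m *+ k)%MM = (mnmwiden m *+ k)%MM.
Proof.
elim: k => [|k IHk]; first by rewrite !mulm0n mnmwiden0.
by rewrite !mulmS mnmwidenD IHk.
Qed.

Lemma psumE n N : (0 < n)%N -> psum n N = \sum_(i < N) 'X_i ^+ n.
Proof.
move=> n0; rewrite to_symfunE //; split=> {N} [N|N|].
- apply/issymP => s; rewrite raddf_sum /= [RHS](reindex_inj (@perm_inj _ s)).
  apply: eq_bigr => i _; rewrite rmorphXn /= msymX; congr ('X_[_] ^+ _).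
  apply/mnmP => j; rewrite !mnmE; congr (nat_of_bool _).
  by rewrite -(inj_eq (@perm_inj _ s)) permKV.
- apply/mpolyP => m; rewrite mcoeff_last_zero !raddf_sum /= big_ord_recr /=.
  rewrite [X in _ + X](_ : _ = 0) ?addr0.
    apply: eq_bigr => i _; rewrite !mcoeffXn. congr (_ %:R); congr (nat_of_bool _).
    by rewrite -mnmwiden1 -mnmwidenMn (inj_eq (@inj_mnmwiden _)).
  rewrite mcoeffXn; case: eqP => // /mnmP /(_ ord_max).
  by rewrite mulmnE mnmE eqxx mnmwiden_ordmax mul1n => nE; rewrite nE in n0.
- exists n.+1 => N; apply: leq_trans (msize_sum _ _ _) _.
  apply/bigmax_leqP => i _.
  by rewrite mpolyXn msizeX mdegMn mdeg1 mul1n.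
Qed.

Let is_symfun_msum d (P : forall N, pred 'X_{1..N}) :
    (forall N m, P N m -> (mdeg m <= d)%N) ->
    (forall N (m : 'X_{1..N}) (s : 'S_N), P N [multinom m (s i) | i < N] = P N m) ->
    (forall N m, P N.+1 (mnmwiden m) = P N m) ->
  is_symfun (fun N => \sum_(m : 'X_{1..N < d.+1} | P N m) 'X_[R, m]).
Proof.
move=> degP symP widP.
have coefE N m :
    (\sum_(k : 'X_{1..N < d.+1} | P N k) 'X_[R, k])@_m = (P N m)%:R.
  rewrite raddf_sum /=; have [Pm|nPm] := boolP (P N m).
    have dm : (mdeg m < d.+1)%N by rewrite ltnS degP.
    rewrite (bigD1 (BMultinom dm)) //= mcoeffX eqxx big1 ?addr0 //.
    move=> k /andP[_ kN]; rewrite mcoeffX; case: eqP => // kE.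
    by case/eqP: kN; apply: val_inj.
  rewrite big1 // => k Pk; rewrite mcoeffX; case: eqP => // kE.
  by rewrite -kE Pk in nPm.
split=> [N|N|].
- by apply/issymP => s; apply/mpolyP => m; rewrite mcoeff_sym !coefE symP.
- by apply/mpolyP => m; rewrite mcoeff_last_zero !coefE widP.
- exists d.+1 => N; apply: msize_leP => m dm; rewrite coefE.
  by case: (boolP (P N m)) => // /degP; rewrite leqNgt dm.
Qed.

Lemma hsumE n N :
  hsum n N = \sum_(m : 'X_{1..N < n.+1} | mdeg m == n) 'X_[m].
Proof.
rewrite to_symfunE //.
apply: (is_symfun_msum (P := fun N m => mdeg m == n)) => {N}.
- by move=> N m /eqP->.
- by move=> N m s; rewrite mdeg_mperm.
- move=> N m; rewrite !mdegE big_ord_recr /= mnmwiden_ordmax addn0.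
  by under eq_bigr do rewrite mnmwiden_widen.
Qed.

Lemma msumE la N :
  msum la N = \sum_(m : 'X_{1..N < (sumn la).+1} |
                    perm_eq [seq k <- m : seq nat | k != 0%N] la) 'X_[m].
Proof.
rewrite to_symfunE //.
apply: (is_symfun_msum
  (P := fun N m => perm_eq [seq k <- m : seq nat | k != 0%N] la)) => {N}.
- move=> N m /perm_sumn <-; rewrite sumnE big_filter mdegE.
  rewrite [leqRHS](_ : _ = \sum_(k <- m) k)%N; last first.
    by rewrite big_mkcond /=; apply: eq_bigr => -[].
  by rewrite big_tuple leqnn.
- move=> N m s.
  have /permPl-> // : perm_eq [seq k <- [multinom m (s i) | i < N] | k != 0%N]
                              [seq k <- m : seq nat | k != 0%N].
  apply: perm_filter; apply/tuple_permP; exists s.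
  by congr (val _); apply: eq_from_tnth => i; rewrite !tnth_mktuple.
- by move=> N m /=; rewrite filter_rcons.
Qed.

End Bases.

(* The Hall inner product is given by its defining property: since the [h_la] and the [m_mu] are
   bases, exactly one bilinear form satisfies this. *)
Definition is_hall_product (K : fieldType) (hall : {biscalar symfun K}) : Prop :=
  forall la mu : seq nat, is_part la -> is_part mu ->
    hall (hsum_part K la) (msum K mu) = (la == mu)%:R.

Section HallLittlewood.
Variable K : fieldType.

Definition HL_frac (N : nat) (la : seq nat) : {fraction {mpoly {poly K}[N]}} :=
  let t := tofrac (('X : {poly K})%:MP_[N]) in
  let x (i : 'I_N) := tofrac ('X_i : {mpoly {poly K}[N]}) in
  let lam := mkseq (nth 0%N la) N in
  let v := \prod_(0 <= i < (sumn la).+1)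
             \prod_(1 <= j < (count_mem i lam).+1) ((1 - t ^+ j) / (1 - t)) in
  v^-1 * \sum_(w : 'S_N)
    (\prod_(i < N) x (w i) ^+ nth 0%N lam i) *
    (\prod_(i < N) \prod_(j < N | (i < j)%N)
        ((x (w i) - t * x (w j)) / (x (w i) - x (w j)))).

(* [P_la(x;t)], with coefficients in [K[t]]. The values in at least [size la]
   variables determine an element of the inverse limit; the default [0] of
   [xget] is not used, as [HL_frac N la] is a polynomial with coefficients in
   [K[t]] and is stable in [N]. *)
Definition HL_P (la : seq nat) : symfun {poly K} :=
  xget 0 [set P : symfun {poly K} | forall N : nat, (size la <= N)%N ->
                                      tofrac (P N) = HL_frac N la]%classic.

Definition HL_Q (la : seq nat) : symfun {poly K} :=
  (\prod_(1 <= i < (sumn la).+1)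
     \prod_(1 <= j < (count_mem i la).+1) (1 - 'X ^+ j)) *: HL_P la.

Definition schurQ (la : seq nat) : symfun K :=
  symfun_map (horner_eval (-1 : K)) (HL_Q la).

End HallLittlewood.

Definition alg_dependent (K : fieldType) (A : comAlgType K) (S : set A) : Prop :=
  exists (k : nat) (s : 'I_k -> A) (P : {mpoly K[k]}),
    [/\ injective s, forall i, S (s i), P != 0 & mmap (in_alg A) s P = 0].

(* Main.v *)
(* The value <Q_la(x;-1), p_n> is, up to a nonzero constant, the value of Q_la(x;-1) in n variables at
   the n-th roots of unity: at that point h_k vanishes for 0 < k < n, so only the coefficient of h_n in
   the h-expansion survives, and this is what pairing with p_n = m_n reads off.

   Grouping the symmetrization in P_la by the positions that carry nonzero parts writes Q_la(x;t) as
   (1-t)^l times a sum over injections of {1..l} into the variables, of products of (x_i - t x_j)/(x_i - x_j),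
   and this formula can be specialized at t = -1.  If n is even, each term contains a factor x_i + x_j
   with x_j = - x_i.  If n is odd, let mu be the set of the n-th roots of unity; since the odd power
   sums of mu vanish below degree n, and adding {z, -z} does not change Q at t = -1, the values of Q_nu on
   mu minus R and on -R agree for |nu| < n.  Splitting off the largest part of la thus reduces
   Q_la(mu) to values of Q_nu in one variable, nu being la without its first part; these vanish when nu
   has at least two parts, and give a sign otherwise.

   Algebraic dependence is already visible in degrees 1 and 2: Q_(1)^2 = 2 Q_(2) and Q_(1,1) = 0 at t = -1. *)
From HB Require Import structures.
Require Import Defs.
From mathcomp Require Import all_boot all_order all_algebra all_fingroup all_solvable all_field.
From mathcomp Require Import ring zify.
From mathcomp Require Import boolp classical_sets mpoly.

Set Implicit Arguments.
Unset Strict Implicit.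
Unset Printing Implicit Defensive.

Import GRing.Theory.

Local Open Scope ring_scope.

(** * Sums over injections *)

Section Del.
Variable T : eqType.
Implicit Types (x y : T) (s R : seq T).

Definition del x s := [seq j <- s | j != x].

Lemma del_uniq x s : uniq s -> uniq (del x s).
Proof. exact: filter_uniq. Qed.

Lemma perm_del x s1 s2 : perm_eq s1 s2 -> perm_eq (del x s1) (del x s2).
Proof. exact: perm_filter. Qed.

Lemma del_notin x s : x \notin s -> del x s = s.
Proof.
move=> xs; apply/all_filterP/allP => y ys.
by apply: contra xs => /eqP <-.
Qed.

Lemma del_cons_eq x s : x \notin s -> del x (x :: s) = s.
Proof. by move=> xs; rewrite /del /= eqxx; exact: del_notin. Qed.

Lemma del_cons_neq x r s : r != x -> del x (r :: s) = r :: del x s.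
Proof. by rewrite /del /= => ->. Qed.

Lemma delC x y s : del x (del y s) = del y (del x s).
Proof. by rewrite /del -!filter_predI; apply: eq_filter => z /=; rewrite andbC. Qed.

Lemma mem_del x y s : (y \in del x s) = (y != x) && (y \in s).
Proof. by rewrite mem_filter. Qed.

Lemma del_rem x s : uniq s -> del x s = rem x s.
Proof. by move=> us; rewrite rem_filter. Qed.

Lemma size_del x s : uniq s -> x \in s -> (size (del x s)).+1 = size s.
Proof.
by move=> us xs; rewrite del_rem // size_rem // prednK //; case: s xs {us}.
Qed.

Lemma perm_cons_del x s : uniq s -> x \in s -> perm_eq s (x :: del x s).
Proof. by move=> us xs; rewrite del_rem //; exact: perm_to_rem. Qed.

End Del.

Section HallLittlewoodSum.
Variables (F : fieldType) (t : F).
Implicit Types (x y r : F) (s R : seq F) (la : seq nat).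

Definition hlfrac x y := (x - t * y) / (x - y).

(* The sum over injections of the indices of [la] into [s] that survives when the symmetrization in the
   Hall-Littlewood function is grouped by the positions carrying a nonzero part. *)
Fixpoint hlsum la s : F :=
  if la is l :: la' then
    \sum_(x <- s) x ^+ l * (\prod_(j <- del x s) hlfrac x j) * hlsum la' (del x s)
  else 1.

Lemma perm_hlsum la s1 s2 : perm_eq s1 s2 -> hlsum la s1 = hlsum la s2.
Proof.
elim: la s1 s2 => //= l la IH s1 s2 s12.
rewrite (perm_big _ s12) /=; apply: eq_bigr => x _.
by rewrite (perm_big _ (perm_del x s12)) /= (IH _ _ (perm_del x s12)).
Qed.

Lemma hlsum_cons l la s : hlsum (l :: la) s =
  \sum_(x <- s) x ^+ l * (\prod_(j <- del x s) hlfrac x j) * hlsum la (del x s).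
Proof. by []. Qed.

Arguments hlsum : simpl never.

Lemma hlsum1E l s :
  hlsum [:: l] s = \sum_(x <- s) x ^+ l * \prod_(j <- del x s) hlfrac x j.
Proof. by rewrite hlsum_cons; apply: eq_bigr => x _; rewrite /hlsum mulr1. Qed.

(** The combination kills the term indexed by [r]. In every other term it multiplies by [x - r],
    which cancels the denominator of the extra factor [(x - t * r) / (x - r)] and leaves
    [x - t * r]. *)
Lemma hlsum1_cons l r R : r \notin R ->
  hlsum [:: l.+1] (r :: R) - r * hlsum [:: l] (r :: R) =
  hlsum [:: l.+1] R - t * r * hlsum [:: l] R.
Proof.
move=> rR; rewrite !hlsum1E !big_cons del_cons_eq // mulrDr opprD addrACA.
rewrite exprS -mulrA subrr add0r !mulr_sumr -!sumrB !big_seq.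
apply: eq_bigr => x xR; have rx : r != x by apply: contraNneq rR => ->.
have xr : x - r != 0 by rewrite subr_eq0 eq_sym.
rewrite del_cons_neq // big_cons /hlfrac exprS.
by field.
Qed.

(** When [s] has two distinct elements [r] and [q], applying [hlsum1_cons] to each of them gives two
    linear equations for the two unknown values, with determinant [r - q]; the right-hand sides are
    known by induction on the size. *)
Lemma hlsum1_small s : uniq s ->
  hlsum [:: 0%N] s = \sum_(i < size s) t ^+ i /\ hlsum [:: 1%N] s = \sum_(x <- s) x.
Proof.
have [m] := ubnP (size s); elim: m s => // m IH [|r [|q R]] sm us.
- by rewrite !hlsum1E !big_nil big_ord0.
- by rewrite !hlsum1E !big_seq1 big_ord1 /del /= eqxx !big_nil expr0 !mulr1.
move: us => /= /and3P[]; rewrite inE negb_or => /andP[rq rR] qR uR.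
have [b0q b1q] := IH (q :: R) sm ltac:(by rewrite /= qR).
have [b0r b1r] := IH (r :: R) sm ltac:(by rewrite /= rR).
rewrite [size (q :: R)]/= in b0q; rewrite [size (r :: R)]/= in b0r.
have Hr := @hlsum1_cons 0 r (q :: R) ltac:(by rewrite inE negb_or rq).
have Hq := @hlsum1_cons 0 q (r :: R) ltac:(by rewrite inE negb_or eq_sym rq).
have P : perm_eq [:: q, r & R] [:: r, q & R].
  by rewrite (perm_catCA [:: q] [:: r] R).
rewrite !(perm_hlsum _ P) b0r b1r in Hq; rewrite b0q b1q in Hr.
have -> : \sum_(i < size [:: r, q & R]) t ^+ i =
          1 + t * \sum_(i < (size R).+1) t ^+ i.
  by rewrite big_ord_recl mulr_sumr; congr (_ + _); apply: eq_bigr => i _; rewrite -exprS.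
move: Hq Hr.
move: (hlsum [:: 0%N] [:: r, q & R]) (hlsum [:: 1%N] [:: r, q & R]) => B0 B1.
set c := \sum_(i < _) _; rewrite !big_cons.
set S := \sum_(i <- R) i => Hq Hr.
have /eqP : (r - q) * (B0 - (1 + t * c)) = 0.
  have -> : (r - q) * (B0 - (1 + t * c)) =
   (B1 - q * B0 - (r + S - t * q * c)) - (B1 - r * B0 - (q + S - t * r * c)) by ring.
  by rewrite Hq Hr !subrr.
rewrite mulf_eq0 !subr_eq0 (negPf rq) /= => /eqP B0E; split=> //.
by move/eqP: Hr; rewrite B0E subr_eq => /eqP ->; ring.
Qed.

End HallLittlewoodSum.

Arguments hlsum {F} t la s : simpl never.

Section SchurQ.
Variable F : fieldType.
Implicit Types (x y r : F) (s R : seq F) (la : seq nat).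

(** At t = -1 the factor [(x + y) / (x - y)] is antisymmetric, while the rest of the double sum over
    the first two indices is symmetric once the exponents are exchanged. *)
Lemma hlsum_swap l k la s : uniq s ->
  hlsum (-1) [:: l, k & la] s = - hlsum (-1 : F) [:: k, l & la] s.
Proof.
move=> us.
pose f : F -> F -> F := hlfrac (-1).
have expand a b : hlsum (-1) [:: a, b & la] s =
  \sum_(x <- s) \sum_(y <- s | y != x) x ^+ a * y ^+ b * f x y *
   ((\prod_(j <- del y (del x s)) f x j) * (\prod_(j <- del y (del x s)) f y j) *
     hlsum (-1) la (del y (del x s))).
  rewrite hlsum_cons; apply: eq_bigr => x _; rewrite hlsum_cons mulr_sumr big_filter.
  rewrite [LHS]big_seq_cond [RHS]big_seq_cond.
  apply: eq_bigr => y /andP[ys yx].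
  have yD : y \in del x s by rewrite mem_del yx ys.
  rewrite (perm_big _ (perm_cons_del (del_uniq x us) yD)) /= big_cons -/f.
  ring.
rewrite !expand [LHS](exchange_big_dep xpredT) //= -sumrN; apply: eq_bigr => x _.
rewrite -sumrN (eq_bigl (fun y => y != x)) => [|y]; last by rewrite eq_sym.
apply: eq_bigr => y yx; rewrite delC.
have -> : f y x = - f x y.
  rewrite /f /hlfrac !mulN1r !opprK -[y - x]opprB invrN mulrN [y + x]addrC; ring.
ring.
Qed.

End SchurQ.

(** * Values at the roots of unity *)

Section RootsOfUnity.
Variables (L : fieldType) (charL : [pchar L] =i pred0) (n : nat) (zeta : L).
Hypothesis zetaP : n.-primitive_root zeta.
Implicit Types (x y r z : L) (s R : seq L) (la : seq nat).

Definition unity : seq L := [seq zeta ^+ i | i <- iota 0 n].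

Let n_gt0 : (0 < n)%N := prim_order_gt0 zetaP.

Let natL_neq0 k : (0 < k)%N -> k%:R != 0 :> L.
Proof. by move=> k0; rewrite ((pcharf0P _).1 charL) -lt0n. Qed.

Lemma prod_unity : \prod_(z <- unity) ('X - z%:P) = 'X^n - 1.
Proof. by rewrite big_map -(factor_Xn_sub_1 zetaP) /index_iota subn0. Qed.

Lemma mem_unity z : (z \in unity) = (z ^+ n == 1).
Proof. by rewrite -root_prod_XsubC prod_unity rootE !hornerE subr_eq0. Qed.

Lemma unity_uniq : uniq unity.
Proof.
rewrite map_inj_in_uniq ?iota_uniq // => i j; rewrite !mem_iota add0n => /andP[_ i_n] /andP[_ j_n].
by move/eqP; rewrite (eq_prim_root_expr zetaP) !modn_small // => /eqP.
Qed.

Lemma size_unity : size unity = n.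
Proof. by rewrite size_map size_iota. Qed.

Lemma sum_unity l : \sum_(z <- unity) z ^+ l = if (n %| l)%N then n%:R else 0.
Proof.
rewrite big_map; under eq_bigr do rewrite -exprM mulnC exprM.
have -> : \sum_(i <- iota 0 n) zeta ^+ l ^+ i = \sum_(i < n) zeta ^+ l ^+ i.
  by rewrite -(big_mkord xpredT (fun i => zeta ^+ l ^+ i)) /index_iota subn0.
case: ifPn => [/dvdnP[k ->]|nl].
  rewrite mulnC exprM (prim_expr_order zetaP) expr1n.
  by under eq_bigr do rewrite expr1n; rewrite sumr_const card_ord.
have := subrX1 (zeta ^+ l) n; rewrite -exprM mulnC exprM (prim_expr_order zetaP) expr1n subrr.
move/esym/eqP; rewrite mulf_eq0 subr_eq0 => /orP[|/eqP->//].
by rewrite -(prim_order_dvd zetaP) (negPf nl).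
Qed.

Lemma unity_neq0 z : z \in unity -> z != 0.
Proof.
by rewrite mem_unity; apply: contraTneq => ->; rewrite expr0n gtn_eqF ?n_gt0 // eq_sym oner_eq0.
Qed.

Lemma hlsum_unity_even l la : ~~ odd n -> hlsum (-1) (l :: la) unity = 0.
Proof.
move=> n_even; rewrite hlsum_cons big1_seq // => z /andP[_ zU].
rewrite (_ : \prod_(j <- _) _ = 0) ?mulr0 ?mul0r //.
apply/eqP; rewrite prodf_seq_eq0; apply/hasP; exists (- z); last first.
  by rewrite /hlfrac mulN1r opprK addrN mul0r /=.
rewrite mem_del !mem_unity.
rewrite exprNn -signr_odd (negPf n_even) mul1r -mem_unity zU andbT.
by rewrite eq_sym -addr_eq0 -mulr2n -mulr_natl mulf_neq0 ?natL_neq0 ?unity_neq0.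
Qed.

Hypothesis n_odd : odd n.

Lemma unityD_neq0 z r : z \in unity -> r \in unity -> z + r != 0.
Proof.
rewrite !mem_unity => /eqP zn /eqP rn; apply/eqP => /eqP; rewrite addr_eq0 => /eqP zr.
have /eqP := zn; rewrite zr exprNn -signr_odd n_odd rn mulr1 eq_sym -addr_eq0.
by rewrite (negPf (natL_neq0 (isT : (0 < 2)%N))).
Qed.

(** With [q = ('X^n - 1) / ('X - z)], the denominators multiply to [q.[z] = n / z], read off the
    derivative of ['X^n - 1]. The numerators multiply to [q.[- z] = z^-1], with no sign since
    [n - 1] is even. *)
Lemma prod_hlfrac_unity z : z \in unity ->
  \prod_(j <- del z unity) hlfrac (-1) z j = n%:R^-1.
Proof.
move=> zU; have z0 := unity_neq0 zU.
have zn : z ^+ n = 1 by apply/eqP; rewrite -mem_unity.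
pose q := \prod_(j <- del z unity) ('X - j%:P).
have qE : ('X - z%:P) * q = 'X^n - 1.
  by rewrite -prod_unity (perm_big _ (perm_cons_del unity_uniq zU)) big_cons.
have q1 : q.[z] = n%:R / z.
  have := congr1 (fun p : {poly L} => p^`().[z]) qE.
  rewrite /= derivM derivXsubC derivB derivC derivXn subr0 !hornerE subrr mul0r addr0 => ->.
  rewrite hornerMn hornerXn -mulr_natl; congr (_ * _).
  by apply: (mulfI z0); rewrite -exprS prednK // zn divff.
have q2 : q.[- z] = z^-1.
  have := congr1 (fun p : {poly L} => p.[- z]) qE.
  rewrite !hornerE exprNn -signr_odd n_odd zn mulr1 /= expr1 => H.
  apply: (mulfI z0); rewrite divff //.
  apply: (mulfI (natL_neq0 (isT : (0 < 2)%N))); apply: oppr_inj.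
  have -> : - (2%:R * (z * q.[- z])) = (- z - z) * q.[- z] by ring.
  by rewrite H; ring.
rewrite /hlfrac prodf_div.
have -> : \prod_(j <- del z unity) (z - j) = q.[z].
  by rewrite horner_prod; apply: eq_bigr => j _; rewrite !hornerE.
have -> : \prod_(j <- del z unity) (z - -1 * j) = q.[- z].
  have sgn : \prod_(j <- del z unity) (-1) = 1 :> L.
    rewrite big_const_seq count_predT iter_mulr_1 -signr_odd.
    have := size_del unity_uniq zU; rewrite size_unity => sE.
    by move: n_odd; rewrite -sE /= => /negPf->.
  rewrite horner_prod -[LHS]mul1r -[X in X * _]sgn -big_split.
  by apply: eq_bigr => j _ /=; rewrite !hornerE; ring.
by rewrite q1 q2 invf_div mulrA mulVf // mul1r.
Qed.

(** The factor that appears when [r] is removed from a product of [hlfrac (-1) z]. It vanishes at z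
    = r, so a sum over all of [unity] weighted by these factors only sees the points outside [R]. *)
Definition gfrac z r := (z - r) / (z + r).

Lemma gfrac_hlfrac z r : gfrac z r = (hlfrac (-1) z r)^-1.
Proof. by rewrite /gfrac /hlfrac mulN1r opprK invf_div. Qed.

(** By [prod_hlfrac_unity], for [R] inside [unity] this is the one-part sum [hlsum (-1) [:: l]] over
    the complement of [R]. *)
Definition unity_mean l R : L :=
  n%:R^-1 * \sum_(z <- unity) z ^+ l * \prod_(r <- R) gfrac z r.

(** The counterpart of [hlsum1_cons]: multiplying the new factor by [z + r], nonzero because [n] is
    odd, leaves [z - r]. *)
Lemma unity_mean_cons l r R : r \in unity ->
  unity_mean l.+1 (r :: R) + r * unity_mean l (r :: R) =
  unity_mean l.+1 R - r * unity_mean l R.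
Proof.
move=> rU; rewrite /unity_mean !(mulrCA r) -mulrDr -mulrBr; congr (_ * _).
rewrite !mulr_sumr -big_split -sumrB /= !big_seq; apply: eq_bigr => z zU.
have zr := unityD_neq0 zU rU.
by rewrite !big_cons /gfrac !exprS; field.
Qed.

Lemma perm_unity_mean l R1 R2 : perm_eq R1 R2 -> unity_mean l R1 = unity_mean l R2.
Proof.
by move=> P; congr (_ * _); apply: eq_bigr => z _; rewrite (perm_big _ P).
Qed.

Lemma unity_mean0 l : unity_mean l [::] = (n %| l)%N%:R.
Proof.
rewrite /unity_mean; under eq_bigr do rewrite big_nil mulr1.
by rewrite sum_unity; case: ifP => _; rewrite ?mulr0 // mulVf // natL_neq0.
Qed.

Lemma unity_mean_n R : unity_mean n R = unity_mean 0 R.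
Proof.
congr (_ * _); rewrite !big_seq; apply: eq_bigr => z.
by rewrite mem_unity => /eqP ->; rewrite expr0.
Qed.

(** For two or more points the linear system of [hlsum1_small] works again. A single point has to be
    treated by hand, using that [unity_mean] takes the same value in degrees [0] and [n]. *)
Lemma unity_mean_small R : (1 < n)%N -> uniq R -> {subset R <= unity} ->
  unity_mean 0 R = 1 - hlsum (-1) [:: 0%N] R /\
  unity_mean 1 R = - hlsum (-1) [:: 1%N] R.
Proof.
move=> n1 uR RU; have [-> ->] := hlsum1_small (-1) uR.
have [m] := ubnP (size R); elim: m R uR RU => // m IH [|r [|q R]] uR RU sm.
- by rewrite !unity_mean0 big_ord0 big_nil dvdn0 dvdn1 gtn_eqF ?subr0 ?oppr0.
- rewrite big_ord1 big_seq1 expr0 subrr.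
  have rU : r \in unity by rewrite RU ?inE.
  have rn : r ^+ n = 1 by apply/eqP; rewrite -mem_unity.
  (* As long as the degrees stay strictly between 0 and [n], the right-hand side of
     [unity_mean_cons] is zero and the values form a geometric progression. The equations at 0 and
     at [n.-1] then close the cycle and determine both unknowns. *)
  have step l : (0 < l < n)%N ->
      unity_mean l [:: r] = (- r) ^+ l.-1 * unity_mean 1 [:: r].
    elim: l => // -[|l] IHl /andP[_ ln]; first by rewrite mul1r.
    have := unity_mean_cons l.+1 [::] rU.
    rewrite !unity_mean0 !gtnNdvd ?(ltnW ln) // mulr0 subr0 => /eqP.
    rewrite addr_eq0 => /eqP->; rewrite IHl ?(ltnW ln) //= exprS; ring.
  have E0 := unity_mean_cons 0 [::] rU.
  have En := unity_mean_cons n.-1 [::] rU.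
  have n1' : (0 < n.-1 < n)%N by lia.
  have n1d : (n %| n.-1)%N = false by case/andP: n1' => ? ?; rewrite gtnNdvd.
  rewrite prednK // unity_mean_n (step n.-1) // !unity_mean0 dvdnn n1d /= mulr0n mulr1n mulr0 subr0 in En.
  rewrite !unity_mean0 dvdn0 dvdn1 (gtn_eqF n1) /= mulr0n mulr1n in E0.
  have rE : (- r) ^+ n.-2 * (r * r) = - 1.
    have -> : r * r = - r * - r by rewrite mulrNN.
    rewrite mulrA -!exprSr (_ : n.-2.+2 = n); last by lia.
    by rewrite exprNn -signr_odd n_odd rn mulr1.
  have r0 := unity_neq0 rU.
  set a := unity_mean 0 _ in E0 En *; set b := unity_mean 1 _ in E0 En *.
  have a_b : r * a = r + b.
    have -> : r * a = r * (a + r * ((- r) ^+ n.-2 * b)) - (- r) ^+ n.-2 * (r * r) * b by ring.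
    by rewrite rE En; ring.
  have bE : b = - r.
    have /eqP : 2%:R * (b + r) = 0.
      have -> : 2%:R * (b + r) = (b + r * a) - (0 - r * 1) by rewrite a_b; ring.
      by rewrite E0 subrr.
    by rewrite mulf_eq0 (negPf (natL_neq0 (isT : (0 < 2)%N))) addr_eq0 => /eqP.
  split=> //; move/eqP: a_b; rewrite bE subrr mulf_eq0 (negPf r0) => /eqP //.
have/andP[rqR uqR] := uR; have/andP[qR' uR'] := uqR.
move: rqR; rewrite inE negb_or => /andP[rq rR].
have rU : r \in unity by rewrite RU ?inE ?eqxx.
have qU : q \in unity by rewrite RU ?inE ?eqxx ?orbT.
have urR : uniq (r :: R) by rewrite cons_uniq rR.
have [b0q b1q] := IH (q :: R) uqR ltac:(by move=> z zR; rewrite RU // inE zR orbT) sm.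
have rRU : {subset r :: R <= unity}.
  by move=> z; rewrite inE => /orP[/eqP->//|zR]; rewrite RU // !inE zR !orbT.
have [b0r b1r] := IH (r :: R) urR rRU sm.
have Hr := unity_mean_cons 0 (q :: R) rU.
have Hq := unity_mean_cons 0 (r :: R) qU.
have P : perm_eq [:: q, r & R] [:: r, q & R] by rewrite (perm_catCA [:: q] [:: r] R).
rewrite !(perm_unity_mean _ P) b0r b1r in Hq; rewrite b0q b1q in Hr.
rewrite [size (q :: R)]/= in Hr; rewrite [size (r :: R)]/= in Hq.
have -> : \sum_(i < size [:: r, q & R]) (-1) ^+ i =
          1 - \sum_(i < (size R).+1) (-1) ^+ i :> L.
  by rewrite big_ord_recl -sumrN; congr (_ + _); apply: eq_bigr => i _; rewrite exprS mulN1r.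
move: Hq Hr.
move: (unity_mean 0 [:: r, q & R]) (unity_mean 1 [:: r, q & R]) => B0 B1.
set c := \sum_(i < _) _; rewrite !big_cons; set S := \sum_(i <- R) i => Hq Hr.
have /eqP : (r - q) * (B0 - c) = 0.
  have -> : (r - q) * (B0 - c) = (B1 + r * B0 - (- (q + S) - r * (1 - c)))
     - (B1 + q * B0 - (- (r + S) - q * (1 - c))) by ring.
  by rewrite Hq Hr !subrr.
rewrite mulf_eq0 !subr_eq0 (negPf rq) /= => /eqP B0E; split; first by rewrite B0E; ring.
have -> : B1 = (B1 + r * B0) - r * B0 by ring.
by rewrite Hr B0E; ring.
Qed.

(** The sign [(-1) ^+ l] turns the recursion [hlsum1_cons] at t = -1 into [unity_mean_cons], so
    agreement in degree 1 propagates upwards. Degree 0 is excluded, as the two sides of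
    [unity_mean_small] differ there by 1. *)
Lemma unity_mean_hlsum l R : (0 < l < n)%N -> uniq R -> {subset R <= unity} ->
  unity_mean l R = (-1) ^+ l * hlsum (-1) [:: l] R.
Proof.
move=> /andP[]; case: l => // l _ ln.
elim: l ln R => [|l IHl] ln R uR RU.
  by rewrite (unity_mean_small ln uR RU).2 mulN1r.
elim: R uR RU => [|r R IHR] uR RU.
  by rewrite unity_mean0 gtnNdvd // hlsum_cons big_nil mulr0.
have/andP[rR uR'] := uR.
have rU : r \in unity by rewrite RU ?inE ?eqxx.
have RU' : {subset R <= unity} by move=> z zR; rewrite RU // inE zR orbT.
have ln' := ltnW ln.
have H1 := unity_mean_cons l.+1 R rU; rewrite !IHl // IHR // in H1.
rewrite (canRL (addrK _) H1) (canRL (subrK _) (hlsum1_cons (-1) l.+1 rR)) !exprS.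
ring.
Qed.

(** Induction on [la]: the first part [k] of [la] is placed either at [z] or at a point of [R]. What
    survives is [hlsum (-1) [:: k, l & la] R], and [hlsum_swap] restores the order of [l] and [k]
    with the right sign. *)
Lemma unity_mean_hlsum_cons l la R :
  (0 < l)%N -> 0%N \notin la -> (l + sumn la < n)%N ->
  uniq R -> {subset R <= unity} ->
  n%:R^-1 * (\sum_(z <- unity | z \notin R)
     z ^+ l * (\prod_(r <- R) gfrac z r) * hlsum (-1) la (z :: R)) =
  (-1) ^+ l * hlsum (-1) (l :: la) R.
Proof.
move=> l0; elim: la R => [|k la IH] R la0 ln uR RU.
  rewrite -unity_mean_hlsum //; last by move: ln; rewrite /= addn0 l0 => ->.
  congr (_ * _); rewrite big_mkcond; apply: eq_bigr => z _.
  case: ifPn => [|/negPn zR]; first by rewrite /hlsum mulr1.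
  rewrite (_ : \prod_(r <- R) _ = 0) ?mulr0 //.
  by apply/eqP; rewrite prodf_seq_eq0; apply/hasP; exists z; rewrite // /gfrac subrr mul0r /=.
move: la0; rewrite inE negb_or eq_sym -lt0n => /andP[k0 la0].
rewrite /= in ln.
have gf0 z r : z \in unity -> r \in unity -> z != r ->
    gfrac z r != 0 /\ hlfrac (-1) z r != 0.
  move=> zU rU zr; have zr0 := unityD_neq0 zU rU.
  rewrite -[hlfrac _ _ _ == 0]invr_eq0 -gfrac_hlfrac.
  by split; rewrite /gfrac mulf_neq0 ?invr_eq0 ?subr_eq0.
have Hgf z R' : z \in unity -> z \notin R' -> {subset R' <= R} ->
    (\prod_(r <- R') gfrac z r) * (\prod_(r <- R') hlfrac (-1) z r) = 1.
  move=> zU zR' R'R; rewrite -big_split big1_seq // => r /andP[_ rR'].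
  rewrite /= gfrac_hlfrac mulVf //.
  have zr : z != r by apply: contraNneq zR' => ->.
  by have [] := gf0 z r zU (RU _ (R'R _ rR')) zr.
pose D r := \prod_(j <- del r R) hlfrac (-1) r j.
pose S r := \sum_(z <- unity | z \notin R)
   z ^+ l * (\prod_(j <- del r R) gfrac z j) * hlsum (-1) la (z :: del r R).
(* If [k] sits at [z], the [gfrac] and [hlfrac] products cancel. If it sits at [r], the factor
   linking [r] to [z] is the negative inverse of [gfrac z r], so [r] disappears from the weight of
   [z] at the price of a sign. *)
have step z : z \in unity -> z \notin R ->
   z ^+ l * (\prod_(r <- R) gfrac z r) * hlsum (-1) (k :: la) (z :: R) =
   z ^+ (l + k) * hlsum (-1) la R - \sum_(r <- R) r ^+ k * D r *
    (z ^+ l * (\prod_(j <- del r R) gfrac z j) * hlsum (-1) la (z :: del r R)).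
  move=> zU zR; rewrite hlsum_cons big_cons del_cons_eq // mulrDr; congr (_ + _).
    rewrite exprD; move: (Hgf z R zU zR (fun _ => id)).
    move: (\prod_(r <- R) gfrac _ _) (\prod_(r <- R) hlfrac _ _ _) (hlsum _ _ _) => a b c ab.
    by have -> : z ^+ l * a * (z ^+ k * b * c) = z ^+ l * z ^+ k * (a * b) * c; [ring | rewrite ab mulr1].
  rewrite mulr_sumr -sumrN [LHS]big_seq [RHS]big_seq; apply: eq_bigr => r rR.
  have zr : z != r by apply: contraNneq zR => ->.
  have rU := RU _ rR; have [g0 h0] := gf0 z r zU rU zr.
  rewrite del_cons_neq // big_cons -/(D r) (perm_big _ (perm_cons_del uR rR)) big_cons /=.
  have -> : hlfrac (-1) r z = - (gfrac z r)^-1.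
    by rewrite gfrac_hlfrac invrK /hlfrac -[r - z]opprB invrN !mulN1r !opprK [r + z]addrC mulrN.
  by field.
rewrite big_seq_cond (eq_bigr (fun z => z ^+ (l + k) * hlsum (-1) la R - \sum_(r <- R) r ^+ k * D r *
    (z ^+ l * (\prod_(j <- del r R) gfrac z j) * hlsum (-1) la (z :: del r R)))); last first.
  by move=> z /andP[zU zR]; exact: step.
rewrite -big_seq_cond sumrB exchange_big /=.
under [X in _ - X]eq_bigr => r _ do rewrite -mulr_sumr -/(S r).
(* The induction hypothesis for [del r R] also counts the point z = r, which [S r] omits; its term
   is subtracted. *)
have SE r : r \in R ->
    n%:R^-1 * S r = (-1) ^+ l * hlsum (-1) (l :: la) (del r R) -
     n%:R^-1 * (r ^+ l * (\prod_(j <- del r R) gfrac r j) * hlsum (-1) la R).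
  move=> rR; have rU := RU _ rR.
  rewrite -IH ?del_uniq //; last 2 first.
  - by move: ln; rewrite addnCA; apply: leq_ltn_trans; rewrite leq_addl.
  - by move=> z; rewrite mem_del => /andP[_ /RU].
  rewrite -mulrBr; congr (_ * _).
  rewrite -[X in _ = X - _]big_filter [X in _ = X - _](bigD1_seq r) /=; last 2 first.
  - by rewrite mem_filter mem_del eqxx rU.
  - by rewrite filter_uniq ?unity_uniq.
  rewrite -(perm_hlsum _ _ (perm_cons_del uR rR)) addrC addrK big_filter_cond.
  apply: eq_bigl => z; rewrite mem_del negb_and negbK.
  by case: eqVneq => [->|]; rewrite ?rR ?andbF ?andbT.
have SumE : n%:R^-1 * \sum_(r <- R) r ^+ k * D r * S r =
    \sum_(r <- R) (r ^+ k * D r * ((-1) ^+ l * hlsum (-1) (l :: la) (del r R)) -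
      n%:R^-1 * (r ^+ (l + k) * hlsum (-1) la R)).
  rewrite mulr_sumr; apply: eq_big_seq => r rR.
  rewrite mulrCA (SE r rR) mulrBr; congr (_ - _).
  have rN : r \notin del r R by rewrite mem_del eqxx.
  have H := Hgf r (del r R) (RU _ rR) rN (fun z zR => mem_subseq (filter_subseq _ _) zR).
  rewrite exprD -/(D r) in H *.
  move: (\prod_(j <- del r R) gfrac r j) (D r) (hlsum _ _ _) H => a b c ab.
  have -> : r ^+ k * b * (n%:R^-1 * (r ^+ l * a * c)) =
    n%:R^-1 * (r ^+ l * r ^+ k * c) * (a * b) by ring.
  by rewrite ab mulr1.
rewrite mulrBr SumE.
rewrite sumrB opprB addrA -mulr_sumr -mulrDr.
rewrite -!mulr_suml -mulrDl.
(* The subtracted terms complete the power sum over the complement of [R] to the one over all of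
   [unity], which vanishes since [0 < l + k < n]. *)
have -> : \sum_(z <- unity | z \notin R) z ^+ (l + k) + \sum_(r <- R) r ^+ (l + k) = 0.
  have -> : \sum_(r <- R) r ^+ (l + k) = \sum_(z <- unity | z \in R) z ^+ (l + k).
    rewrite -[RHS]big_filter; apply: perm_big; apply: uniq_perm; rewrite ?filter_uniq ?unity_uniq //.
    by move=> z; rewrite mem_filter; case: (boolP (z \in R)) => //= /RU ->.
  have : \sum_(z <- unity) z ^+ (l + k) = 0.
    rewrite sum_unity gtnNdvd ?addn_gt0 ?l0 //.
    by apply: leq_ltn_trans ln; rewrite addnA leq_addr.
  by rewrite addrC (bigID (fun z => z \in R)).
rewrite mul0r mulr0 sub0r hlsum_swap // mulrN; congr (- _).
rewrite hlsum_cons mulr_sumr; apply: eq_bigr => r _; rewrite /D; ring.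
Qed.

(* The complement of [R] in the roots of unity carries the same odd power sums of degree below [n] as
   the set of opposites of the elements of [R]. *)
Lemma hlsum_unity_compl la R : 0%N \notin la -> (sumn la < n)%N ->
  uniq R -> {subset R <= unity} ->
  hlsum (-1) la [seq z <- unity | z \notin R] = (-1) ^+ sumn la * hlsum (-1) la R.
Proof.
elim: la R => [|l la IH] R; first by rewrite /hlsum mul1r.
rewrite inE negb_or eq_sym -lt0n /= => /andP[l0 la0] ln uR RU.
rewrite exprD [_ ^+ l * _]mulrC -mulrA -unity_mean_hlsum_cons // mulrCA !mulr_sumr.
rewrite hlsum_cons big_filter big_seq_cond [RHS]big_seq_cond.
apply: eq_bigr => z /andP[zU zR].
have -> : del z [seq j <- unity | j \notin R] = [seq j <- unity | j \notin z :: R].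
  by rewrite /del -filter_predI; apply: eq_filter => j /=; rewrite inE negb_or.
rewrite IH //=; last 3 first.
- by apply: leq_ltn_trans ln; rewrite leq_addl.
- by rewrite zR.
- by move=> j; rewrite inE => /orP[/eqP->|/RU].
(* The product over all points other than [z] is [n%:R^-1]; dividing out the factors in [R] gives
   the [gfrac] weights. *)
have -> : \prod_(j <- [seq j <- unity | j \notin z :: R]) hlfrac (-1) z j =
   n%:R^-1 * \prod_(r <- R) gfrac z r.
  rewrite -(prod_hlfrac_unity zU).
  rewrite [X in _ = X * _](bigID (fun j => j \in R)) /= [X in _ = X * _]mulrC -mulrA -[LHS]mulr1.
  congr (_ * _).
    by rewrite !big_filter_cond; apply: eq_bigl => j; rewrite inE negb_or andbT.
  symmetry.
  rewrite -big_filter (perm_big R) /=; last first.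
    apply: uniq_perm; rewrite ?filter_uniq ?unity_uniq // => j.
    rewrite mem_filter mem_del; case: (boolP (j \in R)) => //= jR.
    by rewrite RU // andbT; apply: contraNneq zR => <-.
  rewrite -big_split big1_seq // => r /andP[_ rR] /=.
  rewrite gfrac_hlfrac mulfV //.
  have zr : z != r by apply: contraNneq zR => ->.
  rewrite /hlfrac mulN1r opprK mulf_neq0 ?invr_eq0 ?subr_eq0 //.
  exact: unityD_neq0 zU (RU _ rR).
ring.
Qed.

(** After the first part is placed at [z], [hlsum_unity_compl] with [R = [:: z]] leaves a sum over
    the single point [z]. Two parts do not fit there; with at most one, the exponents of [z] add up
    to [n] and the sum over [z] cancels [n%:R^-1]. *)
Lemma hlsum_unity l la : (0 < l)%N -> 0%N \notin la -> (l + sumn la)%N = n ->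
  hlsum (-1) (l :: la) unity =
    if (size la <= 1)%N then (-1) ^+ sumn la else 0 :> L.
Proof.
move=> l0 la0 ln.
have -> : hlsum (-1) (l :: la) unity =
    n%:R^-1 * \sum_(z <- unity) z ^+ l * ((-1) ^+ sumn la * hlsum (-1) la [:: z]).
  rewrite hlsum_cons mulr_sumr !big_seq; apply: eq_bigr => z zU.
  rewrite prod_hlfrac_unity // (_ : del z unity = [seq j <- unity | j \notin [:: z]]).
    rewrite hlsum_unity_compl //; first ring.
    - by rewrite -ln -[ltnLHS]add0n ltn_add2r.
    - by move=> j; rewrite inE => /eqP->.
  by apply: eq_filter => j; rewrite inE.
have n0 : n%:R != 0 :> L by exact: natL_neq0.
have Hz : \sum_(z <- unity) z ^+ n = n%:R :> L by rewrite sum_unity dvdnn.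
case: la la0 ln => [|k [|m la]] la0 ln.
- under eq_bigr do rewrite /hlsum !mulr1.
  by move: ln; rewrite [sumn _]/= addn0 => ->; rewrite Hz mulVf.
- have kE : sumn [:: k] = k := addn0 k; rewrite kE /= in ln *.
  under eq_bigr => z _ do
    rewrite hlsum1E big_seq1 /del /= eqxx big_nil mulr1 mulrCA -exprD ln.
  by rewrite -mulr_sumr Hz mulrCA mulVf ?mulr1.
- rewrite big1 ?mulr0 // => z _.
  have dz : del z [:: z] = [::] by rewrite /del /= eqxx.
  by rewrite hlsum_cons big_seq1 dz [hlsum _ (m :: _) _]hlsum_cons !big_nil !mulr0.
Qed.

End RootsOfUnity.

(** * The Hall-Littlewood symmetrization *)

Section PermSums.

Lemma lift_perm0_bij n :
  bijective (fun ks : 'I_n.+1 * 'S_n => lift_perm ord0 ks.1 ks.2).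
Proof.
apply: inj_card_bij => [[k s] [k' s'] /= E|]; last first.
  by rewrite card_prod card_ord !card_Sn factS.
have kk : k = k' by rewrite -(lift_perm_id ord0 k s) E lift_perm_id.
subst k'; congr (_, _); apply/permP => i; apply: (@lift_inj _ k).
by rewrite -!(lift_perm_lift ord0) E.
Qed.

Lemma sum_perm_recl (V : nmodType) n (G : 'S_n.+1 -> V) :
  \sum_(w : 'S_n.+1) G w = \sum_(k < n.+1) \sum_(s : 'S_n) G (lift_perm ord0 k s).
Proof.
rewrite pair_bigA /=.
by rewrite (reindex (fun ks : 'I_n.+1 * 'S_n => lift_perm ord0 ks.1 ks.2)) //; apply: onW_bij; apply: lift_perm0_bij.
Qed.

Lemma perm_codom_lift (S : eqType) n (y : 'I_n.+1 -> S) k : injective y ->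
  perm_eq (codom (y \o lift k)) (del (y k) (codom y)).
Proof.
move=> y_inj; apply: uniq_perm.
- by apply/injectiveP => i j /y_inj /lift_inj.
- by apply/del_uniq/injectiveP.
move=> z; rewrite mem_del; apply/codomP/andP => [[j -> /=]|[zk /codomP[i zE]]].
  by rewrite codom_f (inj_eq y_inj) eq_sym neq_lift.
rewrite zE (inj_eq y_inj) in zk *; case: (unliftP k i) => [j ->|ik]; first by exists j.
by rewrite ik eqxx in zk.
Qed.

Variables (F : fieldType) (t : F).

(** The symmetrization defining P before normalization, at arbitrary points; [nth] supplies the zero
    parts. *)
Definition hlsym n (la : seq nat) (y : 'I_n -> F) : F :=
  \sum_(w : 'S_n) (\prod_(i < n) y (w i) ^+ nth 0%N la i) *
    (\prod_(i < n) \prod_(j < n | (i < j)%N) hlfrac t (y (w i)) (y (w j))).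

Lemma hlsym_recl n la (y : 'I_n.+1 -> F) :
  hlsym la y = \sum_(k < n.+1) y k ^+ head 0%N la *
     (\prod_(j < n) hlfrac t (y k) (y (lift k j))) * hlsym (behead la) (y \o lift k).
Proof.
rewrite /hlsym sum_perm_recl; apply: eq_bigr => k _.
rewrite mulr_sumr; apply: eq_bigr => s _.
rewrite !big_ord_recl /= lift_perm_id nth0.
have -> : \prod_(j < n.+1 | (0 < j)%N) hlfrac t (y k) (y (lift_perm ord0 k s j)) =
    \prod_(j < n) hlfrac t (y k) (y (lift k j)).
  rewrite big_mkcond big_ord_recl /= mul1r [RHS](reindex_inj (@perm_inj _ s)).
  by apply: eq_bigr => j _; rewrite lift_perm_lift.
have -> : \prod_(i < n) \prod_(j < n.+1 | (lift ord0 i < j)%N)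
     hlfrac t (y (lift_perm ord0 k s (lift ord0 i))) (y (lift_perm ord0 k s j)) =
   \prod_(i < n) \prod_(j < n | (i < j)%N) hlfrac t (y (lift k (s i))) (y (lift k (s j))).
  apply: eq_bigr => i _; rewrite big_mkcond big_ord_recl /= mul1r [RHS]big_mkcond.
  by apply: eq_bigr => j _; rewrite !lift_perm_lift /bump /= !add1n ltnS.
have -> : \prod_(i < n) y (lift_perm ord0 k s (lift ord0 i)) ^+ nth 0%N la (lift ord0 i) =
   \prod_(i < n) y (lift k (s i)) ^+ nth 0%N (behead la) i.
  by apply: eq_bigr => i _; rewrite lift_perm_lift nth_behead.
ring.
Qed.

(** The t-factorial of [m]. *)
Definition qfact m : F := \prod_(1 <= j < m.+1) ((1 - t ^+ j) / (1 - t)).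

(** Permutations are sorted by the image of the first index. Once the parts are used up, each
    further position contributes a geometric sum in t by [hlsum1_small], and these sums multiply to
    the t-factorial of the number of zero exponents. *)
Lemma hlsym_hlsum n la (y : 'I_n -> F) : t != 1 -> injective y -> (size la <= n)%N ->
  hlsym la y = qfact (n - size la) * hlsum t la (codom y).
Proof.
move=> t1; elim: n la y => [|n IH] la y y_inj.
  rewrite leqn0 size_eq0 => /eqP ->; rewrite /qfact big_geq // mul1r /hlsum /hlsym.
  by under eq_bigr do rewrite !big_ord0 mulr1; rewrite sumr_const card_Sn.
have y_inj' k : injective (y \o lift k) by move=> i j /y_inj /lift_inj.
have prodE k : \prod_(j < n) hlfrac t (y k) (y (lift k j)) =
   \prod_(z <- del (y k) (codom y)) hlfrac t (y k) z.
  rewrite -(perm_big _ (perm_codom_lift k y_inj)) /=.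
  by rewrite big_map big_enum.
have sumE G : \sum_(x <- codom y) G x = \sum_(k < n.+1) G (y k) :> F.
  by rewrite big_map big_enum.
rewrite hlsym_recl; case: la => [_|l la] /=.
  under eq_bigr => k _ do rewrite IH // prodE expr0 mul1r /= subn0 mulr1.
  rewrite -mulr_suml -(sumE (fun x => \prod_(z <- del x (codom y)) hlfrac t x z)).
  have := (hlsum1_small t ((introT (injectiveP _) y_inj) : uniq (codom y))).1.
  rewrite hlsum1E; under eq_bigr do rewrite expr0 mul1r.
  move=> ->; rewrite size_codom card_ord subn0 /qfact [in RHS]big_nat_recr //= mulr1 mulrC.
  congr (_ * _); have t1' : 1 - t != 0 by rewrite subr_eq0 eq_sym.
  apply: (mulIf t1'); rewrite divfK // mulrC.
  by rewrite -opprB -[1 - t ^+ _]opprB subrX1 mulNr.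
rewrite ltnS subSS => lan.
under eq_bigr => k _ do rewrite IH // prodE (perm_hlsum _ _ (perm_codom_lift k y_inj)).
rewrite hlsum_cons sumE mulr_sumr; apply: eq_bigr => k _; ring.
Qed.

End PermSums.

Lemma sum_count_mem (T : eqType) (r la : seq T) : uniq r -> {subset la <= r} ->
  (\sum_(i <- r) count_mem i la)%N = size la.
Proof.
move=> ur; elim: la => [|x la IH] la_r; first by rewrite big1.
rewrite big_split /= IH => [|z zla]; last by rewrite la_r // inE zla orbT.
rewrite (bigD1_seq x) ?la_r ?inE ?eqxx //= big1 // => i; rewrite eq_sym.
by move=> /negPf ->.
Qed.

Lemma leq_part_sumn (la : seq nat) k : k \in la -> (k <= sumn la)%N.
Proof.
elim: la => //= l la IH; rewrite inE => /orP[/eqP->|/IH]; first exact: leq_addr.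
by move/leq_trans; apply; exact: leq_addl.
Qed.

Lemma mkseq_nth_nseq la N : (size la <= N)%N ->
  mkseq (nth 0%N la) N = la ++ nseq (N - size la) 0%N.
Proof.
move=> laN; apply: (@eq_from_nth _ 0%N); first by rewrite size_mkseq size_cat size_nseq subnKC.
move=> i; rewrite size_mkseq => iN; rewrite nth_mkseq // nth_cat; case: ltnP => // lai.
by rewrite nth_default // nth_nseq if_same.
Qed.

Lemma part_subset_iota la : 0%N \notin la -> {subset la <= index_iota 1 (sumn la).+1}.
Proof.
move=> la0 k kla; rewrite mem_index_iota ltnS leq_part_sumn // andbT lt0n.
by apply: contraNneq la0 => <-.
Qed.

(* Regrouping the symmetrization cancels the factor of the normalization coming from the parts equal to [0]. *)
Lemma hl_normalized (F : fieldType) (t : F) N la (y : 'I_N -> F) :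
  (forall k, (0 < k)%N -> 1 - t ^+ k != 0) -> injective y ->
  0%N \notin la -> (size la <= N)%N ->
  (\prod_(1 <= i < (sumn la).+1) \prod_(1 <= j < (count_mem i la).+1) (1 - t ^+ j)) *
  ((\prod_(0 <= i < (sumn la).+1)
     \prod_(1 <= j < (count_mem i (mkseq (nth 0%N la) N)).+1) ((1 - t ^+ j) / (1 - t)))^-1 *
   \sum_(w : 'S_N) (\prod_(i < N) y (w i) ^+ nth 0%N (mkseq (nth 0%N la) N) i) *
     (\prod_(i < N) \prod_(j < N | (i < j)%N)
        ((y (w i) - t * y (w j)) / (y (w i) - y (w j))))) =
  (1 - t) ^+ size la * hlsum t la (codom y).
Proof.
move=> tX y_inj la0 laN.
set b := (X in X * _); set v := (X in X^-1); set S := (X in _ * (_ * X)).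
have t1 : 1 - t != 0 by rewrite -[t]expr1 tX.
have SE : S = hlsym t la y.
  apply: eq_bigr => w _; congr (_ * _); apply: eq_bigr => i _.
  by rewrite nth_mkseq.
have q0 m : qfact t m != 0.
  rewrite /qfact prodf_seq_neq0; apply/allP => j; rewrite mem_index_iota => /andP[j0 _] /=.
  by rewrite mulf_neq0 ?invr_eq0 // tX.
have vE : v = qfact t (N - size la) *
     \prod_(1 <= i < (sumn la).+1) qfact t (count_mem i la).
  rewrite /v big_ltn // mkseq_nth_nseq //; congr (_ * _).
    by rewrite /qfact count_cat count_nseq /= mul1n (count_memPn la0).
  rewrite !big_nat; apply: eq_bigr => i /andP[i0 _].
  by rewrite count_cat count_nseq /= eq_sym (gtn_eqF i0) mul0n addn0.
(* Each factor [1 - t ^+ j] is [1 - t] times a factor of a t-factorial, and the multiplicities of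
   the parts add up to [size la]. *)
have bE : b = (1 - t) ^+ size la *
     \prod_(1 <= i < (sumn la).+1) qfact t (count_mem i la).
  rewrite /b -[X in _ ^+ X](sum_count_mem _ (part_subset_iota la0)) ?iota_uniq //.
  rewrite -prodrXr -big_split /=; apply: eq_bigr => i _.
  rewrite /qfact big_split /= prodr_const_nat subn1 /= mulrCA -exprMn.
  by rewrite mulfV // expr1n mulr1.
rewrite SE hlsym_hlsum //; last by rewrite eq_sym -subr_eq0.
rewrite bE vE invfM.
have : \prod_(1 <= i < (sumn la).+1) qfact t (count_mem i la) != 0.
  by rewrite prodf_seq_neq0; apply/allP => i _; rewrite q0.
move: (\prod_(1 <= i < _) _) (q0 (N - size la)%N) => w; move: (qfact _ _) => u u0 w0.
by field; rewrite ?u0 ?w0.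
Qed.

Lemma tofrac_inj (A : idomainType) : injective (@tofrac A).
Proof. by move=> p q /eqP; rewrite tofrac_eq => /eqP. Qed.

Section HLFrac.
Variable K : fieldType.
Implicit Types (la : seq nat).

Definition hl_t N : {fraction {mpoly {poly K}[N]}} := tofrac (('X : {poly K})%:MP_[N]).
Definition hl_x N (i : 'I_N) : {fraction {mpoly {poly K}[N]}} :=
  tofrac ('X_i : {mpoly {poly K}[N]}).

Definition hl_b la : {poly K} :=
  \prod_(1 <= i < (sumn la).+1) \prod_(1 <= j < (count_mem i la).+1) (1 - 'X ^+ j).

Lemma hl_x_inj N : injective (@hl_x N).
Proof.
move=> i j /tofrac_inj /(congr1 (fun p : {mpoly {poly K}[N]} => p@_(U_(i))%MM)).
rewrite !mcoeffX eqxx; case: eqP => [/mnmP /(_ i)|_ /eqP]; last by rewrite oner_eq0.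
by rewrite !mnmE eqxx; case: eqP.
Qed.

Lemma hl_tX_neq1 N k : (0 < k)%N -> 1 - hl_t N ^+ k != 0.
Proof.
move=> k0; rewrite /hl_t -!rmorphXn -[1](rmorph1 (@tofrac _)) -rmorphB /= tofrac_eq0.
rewrite -mpolyC1 -mpolyCB mpolyC_eq0 subr_eq0 eq_sym.
apply/eqP => /(congr1 (fun p : {poly K} => size p)); rewrite size_polyXn size_poly1.
by case: k k0.
Qed.

Lemma HL_fracE la N : is_part la -> (size la <= N)%N ->
  tofrac ((hl_b la)%:MP_[N]) * HL_frac K N la =
  (1 - hl_t N) ^+ size la * hlsum (hl_t N) la (codom (@hl_x N)).
Proof.
move=> /andP[_ la0] laN.
rewrite -(hl_normalized (@hl_tX_neq1 N) (@hl_x_inj N) la0 laN).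
congr (_ * _); rewrite /hl_b !rmorph_prod /=; apply: eq_bigr => i _.
rewrite !rmorph_prod /=; apply: eq_bigr => j _.
by rewrite !rmorphB /= !rmorph1 !rmorphXn.
Qed.

Lemma hl_b_uniq la : is_part la -> uniq la -> hl_b la = (1 - 'X) ^+ size la.
Proof.
move=> /andP[_ la0] ula.
rewrite -[X in _ ^+ X](sum_count_mem _ (part_subset_iota la0)) ?iota_uniq //.
rewrite -prodrXr /hl_b; apply: eq_bigr => i _; rewrite count_uniq_mem //.
by case: (i \in la); rewrite ?big_nat1 ?expr1 // big_geq.
Qed.

(** For distinct parts [hl_b] is a power of [1 - 'X] that cancels in [HL_fracE]. The existence of P
    is thereby reduced to realizing the sum over injections by a symmetric function. *)
Lemma HL_frac_uniq la N : is_part la -> uniq la -> (size la <= N)%N ->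
  HL_frac K N la = hlsum (hl_t N) la (codom (@hl_x N)).
Proof.
move=> pla ula laN; have := HL_fracE pla laN.
have -> : tofrac (hl_b la)%:MP_[N] = (1 - hl_t N) ^+ size la.
  by rewrite hl_b_uniq // !rmorphXn !rmorphB /= !rmorph1.
by apply: mulfI; rewrite expf_neq0 // -[hl_t N]expr1 hl_tX_neq1.
Qed.

End HLFrac.

(** * Specialization of fractions *)

Section Specialization.
Variables (A : comNzRingType) (F L : fieldType).
Variables (iota : {rmorphism A -> F}) (ev : {rmorphism A -> L}).
Hypothesis iota_inj : injective iota.

(* [ev] extends to the fractions whose denominator it does not kill; this is the graph of the extension. *)
Definition specializes (u : F) (v : L) : Prop :=
  exists a b, [/\ ev b != 0, u = iota a / iota b & v = ev a / ev b].

Let iota_neq0 b : ev b != 0 -> iota b != 0.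
Proof. by apply: contraNneq => /eqP; rewrite -(rmorph0 iota) (inj_eq iota_inj) => /eqP->; rewrite rmorph0. Qed.

Lemma specializes_iota a : specializes (iota a) (ev a).
Proof. by exists a, 1; rewrite !rmorph1 !divr1 oner_neq0. Qed.

(** Clearing the denominator gives an identity in the image of [iota], hence in [A], where [ev] can
    be applied. *)
Lemma specializes_eq a v : specializes (iota a) v -> v = ev a.
Proof.
move=> [b [c [c0 E ->]]]; have ic := iota_neq0 c0.
have : a * c = b by apply: iota_inj; rewrite rmorphM E divfK.
by move=> <-; rewrite rmorphM mulfK.
Qed.

Lemma specializes1 : specializes 1 1.
Proof. by rewrite -(rmorph1 iota) -[X in specializes _ X](rmorph1 ev); apply: specializes_iota. Qed.

Lemma specializes0 : specializes 0 0.
Proof. by rewrite -(rmorph0 iota) -[X in specializes _ X](rmorph0 ev); apply: specializes_iota. Qed.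

Lemma specializesD u1 v1 u2 v2 :
  specializes u1 v1 -> specializes u2 v2 -> specializes (u1 + u2) (v1 + v2).
Proof.
move=> [a1 [b1 [b10 -> ->]]] [a2 [b2 [b20 -> ->]]].
exists (a1 * b2 + a2 * b1), (b1 * b2); rewrite !rmorphD !rmorphM mulf_neq0 //.
by split=> //; rewrite addf_div ?iota_neq0.
Qed.

Lemma specializesM u1 v1 u2 v2 :
  specializes u1 v1 -> specializes u2 v2 -> specializes (u1 * u2) (v1 * v2).
Proof.
move=> [a1 [b1 [b10 -> ->]]] [a2 [b2 [b20 -> ->]]].
exists (a1 * a2), (b1 * b2); rewrite !rmorphM mulf_neq0 //.
by split=> //; rewrite mulf_div.
Qed.

Lemma specializesN u v : specializes u v -> specializes (- u) (- v).
Proof. by move=> [a [b [b0 -> ->]]]; exists (- a), b; rewrite !rmorphN !mulNr. Qed.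

Lemma specializesV u v : v != 0 -> specializes u v -> specializes u^-1 v^-1.
Proof.
move=> v0 [a [b [b0 uE vE]]]; exists b, a; rewrite uE vE !invf_div; split=> //.
by move: v0; rewrite vE mulf_eq0 negb_or => /andP[].
Qed.

Lemma specializesX u v k : specializes u v -> specializes (u ^+ k) (v ^+ k).
Proof.
move=> uv; elim: k => [|k IH]; first exact: specializes1.
by rewrite !exprS; apply: specializesM.
Qed.

Lemma specializes_sum (I : Type) (r : seq I) (f : I -> F) (g : I -> L) :
  (forall i, specializes (f i) (g i)) ->
  specializes (\sum_(i <- r) f i) (\sum_(i <- r) g i).
Proof.
move=> fg; elim: r => [|i r IH]; rewrite ?big_nil ?big_cons; first exact: specializes0.
exact: specializesD.
Qed.

Lemma specializes_prod (I : eqType) (r : seq I) (f : I -> F) (g : I -> L) :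
  (forall i, i \in r -> specializes (f i) (g i)) ->
  specializes (\prod_(i <- r) f i) (\prod_(i <- r) g i).
Proof.
elim: r => [|i r IH] fg; rewrite ?big_nil ?big_cons; first exact: specializes1.
by apply: specializesM; [apply: fg; rewrite inE eqxx | apply: IH => j jr; apply: fg; rewrite inE jr orbT].
Qed.

Lemma del_map (I S : eqType) (f : I -> S) i (r : seq I) : injective f ->
  del (f i) (map f r) = map f (del i r).
Proof. by move=> f_inj; rewrite /del filter_map; congr map; apply: eq_filter => j /=; rewrite (inj_eq f_inj). Qed.

(** The only denominators are differences of the variables, which stay nonzero since [y] is
    injective; no [1 - t ^+ j] is inverted, so t may be sent to -1. *)
Lemma specializes_hlsum (I : eqType) (r : seq I) (x : I -> F) (y : I -> L) t t' la :
  specializes t t' -> (forall i, specializes (x i) (y i)) -> injective x -> injective y ->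
  specializes (hlsum t la (map x r)) (hlsum t' la (map y r)).
Proof.
move=> tt' xy x_inj y_inj; elim: la r => [|l la IH] r; first exact: specializes1.
rewrite !hlsum_cons !big_map; apply: specializes_sum => i; rewrite !del_map //.
apply: specializesM (IH _); apply: specializesM; first exact: specializesX.
rewrite !big_map; apply: specializes_prod => j; rewrite mem_del => /andP[ji _].
apply: specializesM.
  by apply: specializesD => //; apply: specializesN; apply: specializesM.
apply: specializesV; first by rewrite subr_eq0 (inj_eq y_inj) eq_sym.
by apply: specializesD => //; apply: specializesN.
Qed.

End Specialization.

Lemma hlsum_scale (F : fieldType) (t c : F) la s : c != 0 ->
  hlsum t la [seq c * x | x <- s] = c ^+ sumn la * hlsum t la s.
Proof.
move=> c0; have c_inj : injective ( *%R c) by apply: mulfI.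
elim: la s => [|l la IH] s; first by rewrite /hlsum mul1r.
rewrite !hlsum_cons big_map mulr_sumr; apply: eq_bigr => x _.
rewrite (@del_map _ _ ( *%R c)) // IH big_map exprMn /= exprD.
have -> : \prod_(j <- del x s) hlfrac t (c * x) (c * j) = \prod_(j <- del x s) hlfrac t x j.
  apply: eq_bigr => j _; rewrite /hlfrac mulrCA -!mulrBr invfM mulrACA divff //.
  by rewrite mul1r.
ring.
Qed.

Lemma natr_inj (R : idomainType) : [pchar R] =i pred0 -> injective (fun k => k%:R : R).
Proof.
move=> charR k l; wlog kl : k l / (k <= l)%N => [W /= kl|/= /eqP].
  by case/orP: (leq_total k l) => /W; [apply | move=> H; symmetry; apply: H].
rewrite eq_sym -subr_eq0 -natrB // ((pcharf0P _).1 charR) subn_eq0 => lk.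
by apply/eqP; rewrite eqn_leq kl lk.
Qed.

(** * Values and homogeneity of Schur's Q-functions *)

Section SchurQAt.
Variable K : fieldType.
Implicit Types (la : seq nat) (P : symfun {poly K}).

Definition is_HL_P la P : Prop :=
  forall N : nat, (size la <= N)%N -> tofrac (P N) = HL_frac K N la.

Lemma HL_P_is la : HL_P K la = 0 \/ is_HL_P la (HL_P K la).
Proof. by rewrite /HL_P; case: xgetP => [P _ HP|_]; [right|left]. Qed.

Lemma schurQ0 la : HL_P K la = 0 -> schurQ K la = 0.
Proof.
move=> P0; apply: val_inj; apply: functional_extensionality_dep => N.
by rewrite /schurQ /HL_Q P0 scaler0 /=; apply: raddf0.
Qed.

Lemma HL_Q_tofrac la N : is_HL_P la (HL_P K la) -> is_part la -> (size la <= N)%N ->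
  tofrac (HL_Q K la N) =
  (1 - hl_t K N) ^+ size la * hlsum (hl_t K N) la (codom (@hl_x K N)).
Proof.
move=> HP pla laN; rewrite -HL_fracE // -(HP N laN) -tofracM mul_mpolyC.
by [].
Qed.

(** Sending t to -1 and the variables to [y] at once is a ring morphism, under which the formula
    [HL_Q_tofrac] specializes; [1 - t] becomes 2. *)
Lemma mmap_schurQ la N (L : fieldType) (phi : {rmorphism K -> L}) (y : 'I_N -> L) :
  is_HL_P la (HL_P K la) -> is_part la -> (size la <= N)%N -> injective y ->
  mmap phi y (schurQ K la N) = 2%:R ^+ size la * hlsum (-1) la (codom y).
Proof.
move=> HP pla laN y_inj.
pose ev : {rmorphism {mpoly {poly K}[N]} -> L} := mmap (phi \o horner_eval (-1)) y.
have -> : mmap phi y (schurQ K la N) = ev (HL_Q K la N).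
  (* A common degree bound, so that both evaluations run over the same monomials even if
     coefficients vanish at t = -1. *)
  pose d := maxn (msize (schurQ K la N)) (msize (HL_Q K la N)).
  rewrite (@mmapE _ _ _ _ _ _ d) ?leq_maxl // /ev /= (@mmapE _ _ _ _ _ _ d) ?leq_maxr //.
  by apply: eq_bigr => m _; rewrite mcoeff_map_mpoly.
symmetry; apply: (@specializes_eq _ _ _ (@tofrac _) ev (@tofrac_inj _)).
rewrite [X in specializes _ _ X _]HL_Q_tofrac //.
have st : specializes (@tofrac _) ev (hl_t K N) (-1).
  have -> : -1 = ev ('X%:MP_[N]) :> L by rewrite /ev /= mmapC /= /horner_eval hornerX rmorphN1.
  exact: specializes_iota.
apply: specializesM.
  apply: specializesX.
  have -> : 2%:R = 1 + - -1 :> L by rewrite opprK.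
  apply: specializesD; [exact: tofrac_inj | exact: specializes1 | exact: specializesN].
apply: specializes_hlsum => //; [exact: tofrac_inj | | exact: hl_x_inj].
move=> i; have -> : y i = ev 'X_i by rewrite /ev /= mmapX mmap1U.
exact: specializes_iota.
Qed.

Hypothesis charK0 : [pchar K] =i pred0.

(** Doubling all variables, with t fixed, multiplies the sum over injections by [2 ^ sumn la] and
    the coefficient at [m] by [2 ^ mdeg m]; powers of 2 are distinct in characteristic 0. *)
Lemma HL_Q_homog la N m : is_HL_P la (HL_P K la) -> is_part la -> (size la <= N)%N ->
  (HL_Q K la N)@_m != 0 -> mdeg m = sumn la.
Proof.
move=> HP pla laN.
set p := HL_Q K la N.
pose lq : N.-tuple {mpoly {poly K}[N]} := [tuple 2%:R *: 'X_i | i < N].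
pose ev : {rmorphism {mpoly {poly K}[N]} -> {fraction {mpoly {poly K}[N]}}} :=
  @tofrac _ \o comp_mpoly lq.
have lqX k : 'X_[k] \mPo lq = 2%:R ^+ mdeg k *: 'X_[k].
  rewrite comp_mpolyX mpolyXE_id; under eq_bigr do rewrite tnth_mktuple exprZn.
  by rewrite scaler_prod prodrXr mdegE.
have x2_inj : injective (fun i => 2%:R * hl_x K (N:=N) i).
  move=> i j /mulfI H; apply: (@hl_x_inj K); apply: H.
  have -> : 2%:R = tofrac 2%:R :> {fraction {mpoly {poly K}[N]}} by rewrite rmorph_nat.
  rewrite tofrac_eq0 -mpolyC_nat mpolyC_eq0 -polyC_natr polyC_eq0.
  by rewrite ((pcharf0P _).1 charK0).
have E : tofrac (2%:R ^+ sumn la * p) = ev p.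
  apply: (@specializes_eq _ _ _ (@tofrac _) ev (@tofrac_inj _)).
  rewrite tofracM HL_Q_tofrac // tofracXn rmorph_nat mulrCA [X in specializes _ _ X _]HL_Q_tofrac //.
  rewrite -hlsum_scale.
    rewrite -map_comp.
    apply: specializesM.
      apply: specializesX.
      apply: specializesD; [exact: tofrac_inj | exact: specializes1 | apply: specializesN].
      have {2}-> : hl_t K N = ev ('X%:MP_[N]) by rewrite /ev /= comp_mpolyC.
      exact: specializes_iota.
    apply: specializes_hlsum => //; [exact: tofrac_inj | | | exact: hl_x_inj].
      have {2}-> : hl_t K N = ev ('X%:MP_[N]) by rewrite /ev /= comp_mpolyC.
      exact: specializes_iota.
    move=> i /=; have -> : 2%:R * hl_x K i = ev 'X_i.
      rewrite /ev /= lqX mdeg1 expr1 -mul_mpolyC tofracM; congr (_ * _).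
      by rewrite mpolyC_nat rmorph_nat.
    exact: specializes_iota.
  have -> : 2%:R = tofrac 2%:R :> {fraction {mpoly {poly K}[N]}} by rewrite rmorph_nat.
  rewrite tofrac_eq0 -mpolyC_nat mpolyC_eq0 -polyC_natr polyC_eq0.
  by rewrite ((pcharf0P _).1 charK0).
have : 2%:R ^+ sumn la * p = p \mPo lq by exact: tofrac_inj E.
move=> /(congr1 (mcoeff m)).
rewrite comp_mpolyEX raddf_sum /= -mpolyC_nat -rmorphXn mcoeffCM.
have -> : \sum_(k <- msupp p) (p@_k *: ('X_[k] \mPo lq))@_m = 2%:R ^+ mdeg m * p@_m.
  under eq_bigr do rewrite lqX scalerA mcoeffZ mcoeffX.
  have [mp|mp] := boolP (m \in msupp p).
    rewrite (bigD1_seq m) ?msupp_uniq //= eqxx mulr1 mulrC big1 ?addr0 //.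
    by move=> k /negPf ->; rewrite mulr0.
  rewrite (memN_msupp_eq0 mp) mulr0 big1_seq // => k /andP[_ kp].
  by case: eqP => [kE|_]; rewrite ?mulr0 //; rewrite -kE kp in mp.
move=> /eqP; rewrite -subr_eq0 -mulrBl mulf_eq0 => /orP[|/eqP->]; last by rewrite eqxx.
rewrite subr_eq0 -!natrX -!polyC_natr (inj_eq polyC_inj) => E2 _.
by move/eqP: E2 => /(natr_inj charK0) /eqP; rewrite eqn_exp2l // => /eqP.
Qed.

End SchurQAt.

(** * Existence of P for at most two parts *)

Section OnePart.
Variable A : comNzRingType.
Implicit Types (t r : A) (s : seq A) (g : nat -> A).

(** The identity [hlsum1_cons] solved for the value on [r :: s], where [g] holds the values on [s].
    Index 0 stands for the part 1, given by the sum of the variables. *)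
Fixpoint hlpow_step t r g l : A :=
  if l is l'.+1 then g l + r * (hlpow_step t r g l' - t * g l') else g 0%N + r.

(* [hlpow t s l] is [hlsum t [:: l.+1] s] computed without divisions. *)
Definition hlpow t s : nat -> A := foldr (hlpow_step t) (fun=> 0) s.

Lemma hlpow_cons0 t r s : hlpow t (r :: s) 0 = hlpow t s 0 + r.
Proof. by []. Qed.

Lemma hlpow_consS t r s l :
  hlpow t (r :: s) l.+1 = hlpow t s l.+1 + r * (hlpow t (r :: s) l - t * hlpow t s l).
Proof. by []. Qed.

Lemma hlpow_0cons t s l : hlpow t (0 :: s) l = hlpow t s l.
Proof. by case: l => [|l]; rewrite ?hlpow_cons0 ?hlpow_consS ?mul0r addr0. Qed.

(** At t = -1 this says that P_(2) is the square of P_(1), the source of the relation between Q_(1)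
    and Q_(2). *)
Lemma hlpow_sqr s : hlpow (-1) s 1 = hlpow (-1) s 0 ^+ 2.
Proof.
elim: s => [|r s IH]; first by rewrite /= expr0n.
by rewrite hlpow_consS !hlpow_cons0 IH; ring.
Qed.

End OnePart.

Lemma rmorph_hlpow (A B : comNzRingType) (f : {rmorphism A -> B}) t s l :
  f (hlpow t s l) = hlpow (f t) (map f s) l.
Proof.
elim: s l => [|r s IHs] l; first exact: rmorph0.
elim: l => [|l IHl]; first by rewrite /= rmorphD IHs.
by rewrite [map _ _]/= !hlpow_consS rmorphD rmorphM rmorphB rmorphM IHl !IHs.
Qed.

Lemma hlsum1_hlpow (F : fieldType) (t : F) s l : uniq s ->
  hlsum t [:: l.+1] s = hlpow t s l.
Proof.
elim: s l => [|r s IHs] l us; first by rewrite hlsum_cons big_nil.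
have /andP[rs us'] := us.
elim: l => [|l IHl].
  by rewrite (hlsum1_small t us).2 big_cons -(hlsum1_small t us').2 IHs // addrC.
have /(canRL (subrK _)) -> := hlsum1_cons t l.+1 rs.
by rewrite IHl !IHs // hlpow_consS; ring.
Qed.

(** The recursion hides the symmetry, which is visible in the fraction field, where [hlpow] is a sum
    over injections. *)
Lemma perm_hlpow (A : idomainType) (t : A) s1 s2 l : uniq s1 -> perm_eq s1 s2 ->
  hlpow t s1 l = hlpow t s2 l.
Proof.
move=> us1 s12; apply: tofrac_inj.
have us2 : uniq s2 by rewrite -(perm_uniq s12).
rewrite !rmorph_hlpow -!hlsum1_hlpow ?map_inj_uniq //; try exact: tofrac_inj.
by apply: perm_hlsum; apply: perm_map.
Qed.

Lemma msizeD_leq N (R : nzRingType) (p q : {mpoly R[N]}) d :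
  (msize p <= d)%N -> (msize q <= d)%N -> (msize (p + q) <= d)%N.
Proof. by move=> pd qd; apply: leq_trans (msizeD_le _ _) _; rewrite geq_max pd. Qed.

(** Only independence of the number of variables matters; the slope 3 is the cost of one product
    with a linear factor in [msizeM_le]. *)
Lemma msize_hlpow N (R : comNzRingType) (c : R) (s : seq {mpoly R[N]}) l :
  (forall p, p \in s -> msize p <= 2)%N -> (msize (hlpow c%:MP s l) <= 3 * l + 2)%N.
Proof.
elim: s l => [|r s IHs] l s2; first by rewrite msize0.
have {}IHs k : (msize (hlpow c%:MP s k) <= 3 * k + 2)%N.
  by apply: IHs => p ps; apply: s2; rewrite inE ps orbT.
have r2 : (msize r <= 2)%N by apply: s2; rewrite inE eqxx.
elim: l => [|l IHl]; first exact: msizeD_leq.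
rewrite hlpow_consS; apply: msizeD_leq => //.
have : (msize (hlpow c%:MP (r :: s) l - c%:MP * hlpow c%:MP s l) <= 3 * l + 2)%N.
  apply: msizeD_leq => //.
  by rewrite msizeN mul_mpolyC; apply: leq_trans (msizeZ_le _ _) _; exact: IHs.
by move: (_ - _) => q q2; apply: leq_trans (msizeM_le _ _) _; lia.
Qed.

Section TwoParts.
Variables (F : fieldType) (t : F).

Lemma hlsum2E a b s : hlsum t [:: a; b] s =
  \sum_(x <- s) x ^+ a * (\prod_(j <- del x s) hlfrac t x j) * hlsum t [:: b] (del x s).
Proof. exact: hlsum_cons. Qed.

Lemma hlsum1_del b x s : uniq s -> x \in s ->
  hlsum t [:: b.+1] (del x s) =
  hlsum t [:: b.+1] s - x * hlsum t [:: b] s + t * x * hlsum t [:: b] (del x s).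
Proof.
move=> us xs; have xD : x \notin del x s by rewrite mem_del eqxx.
have := hlsum1_cons t b xD.
by rewrite !(perm_hlsum _ _ (perm_cons_del us xs)) => ->; rewrite subrK.
Qed.

Lemma hlsum2_1 a s : uniq s ->
  hlsum t [:: a; 1%N] s = hlsum t [:: a] s * hlsum t [:: 1%N] s - hlsum t [:: a.+1] s.
Proof.
move=> us; rewrite hlsum2E !hlsum1E -!hlsum1E mulr_suml -sumrB.
rewrite [LHS]big_seq [RHS]big_seq; apply: eq_bigr => x xs.
have := (hlsum1_small t us).2; rewrite (perm_big _ (perm_cons_del us xs)) big_cons /= => ->.
by rewrite (hlsum1_small t (del_uniq x us)).2 exprS; ring.
Qed.

(** Substituting [hlsum1_del] in the inner sum moves one unit from the second part to the first, up
    to products of one-part sums. Iterating down to [hlsum2_1] leaves a polynomial in t and one-part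
    sums. *)
Lemma hlsum2_S a b s : uniq s ->
  hlsum t [:: a; b.+1] s = t * hlsum t [:: a.+1; b] s +
    hlsum t [:: a] s * hlsum t [:: b.+1] s - hlsum t [:: a.+1] s * hlsum t [:: b] s.
Proof.
move=> us; rewrite !hlsum2E (hlsum1E t a) (hlsum1E t a.+1) !mulr_suml mulr_sumr -big_split -sumrB /=.
rewrite [LHS]big_seq [RHS]big_seq; apply: eq_bigr => x xs.
by rewrite hlsum1_del // exprS; ring.
Qed.

End TwoParts.

Section Existence.
Variable K : fieldType.

Definition hl_vars (R : comNzRingType) N : seq {mpoly R[N]} := codom (fun i : 'I_N => 'X_i).

Lemma mpolyXU_inj (R : comNzRingType) N : injective (fun i : 'I_N => 'X_i : {mpoly R[N]}).
Proof.
move=> i j /(congr1 (fun p : {mpoly R[N]} => p@_(U_(i))%MM)).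
rewrite !mcoeffX eqxx; case: eqP => [/mnmP /(_ i)|_ /eqP]; last by rewrite oner_eq0.
by rewrite !mnmE eqxx; case: eqP.
Qed.

Lemma hl_vars_uniq (R : comNzRingType) N : uniq (hl_vars R N).
Proof. exact/injectiveP/mpolyXU_inj. Qed.

Lemma perm_hl_vars (R : comNzRingType) N (s : 'S_N) :
  perm_eq (map (msym s) (hl_vars R N)) (hl_vars R N).
Proof.
have -> : map (msym s) (hl_vars R N) = codom (fun i => 'X_(s i) : {mpoly R[N]}).
  by rewrite -map_comp; apply: eq_map => i /=; rewrite /msym mmapX mmap1U.
apply: uniq_perm; first by apply/injectiveP => i j /mpolyXU_inj /perm_inj.
  exact: hl_vars_uniq.
move=> p; apply/codomP/codomP => -[i ->]; first by exists (s i).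
by exists (s^-1%g i); rewrite permKV.
Qed.

Lemma perm_hl_vars_S (R : comNzRingType) N :
  perm_eq (hl_vars R N.+1) ('X_ord_max :: [seq 'X_(lift ord_max j) | j : 'I_N]).
Proof.
have lX_inj : injective (fun j : 'I_N => 'X_(lift ord_max j) : {mpoly R[N.+1]}).
  by move=> i j /mpolyXU_inj /lift_inj.
apply: uniq_perm; first exact: hl_vars_uniq.
  rewrite cons_uniq; apply/andP; split; last exact/injectiveP.
  by apply/negP => /codomP[j /mpolyXU_inj /eqP]; rewrite (negPf (neq_lift _ _)).
move=> p; rewrite inE; apply/codomP/orP => [[i ->]|[/eqP->|/codomP[j ->]]].
- by case: (unliftP ord_max i) => [j ->|->]; [right; apply: codom_f | left].
- by exists ord_max.
- by exists (lift ord_max j).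
Qed.

Definition hlpow_fam l : polyfam {poly K} := fun N => hlpow 'X%:MP_[N] (hl_vars {poly K} N) l.

Lemma hlpow_fam_symfun l : is_symfun (hlpow_fam l).
Proof.
split=> [N|N|].
- apply/issymP => s; rewrite /hlpow_fam rmorph_hlpow /= /msym mmapC -/(msym s).
  apply: perm_hlpow; last exact: perm_hl_vars.
  by rewrite (perm_uniq (perm_hl_vars _ _)) hl_vars_uniq.
(* With the last variable moved to the front, [hlpow_0cons] erases it once it is set to 0. *)
- rewrite /hlpow_fam (perm_hlpow _ _ (hl_vars_uniq _ _) (perm_hl_vars_S _ _)).
  rewrite /last_zero rmorph_hlpow /= comp_mpolyC comp_mpolyXU -tnth_nth tnth_mktuple unlift_none /=.
  rewrite [LHS]hlpow_0cons; congr hlpow; rewrite -map_comp; apply: eq_map => j /=.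
  by rewrite comp_mpolyXU -tnth_nth tnth_mktuple liftK.
- exists (3 * l + 2)%N => N; apply: msize_hlpow => p /codomP[i ->].
  by rewrite msizeX mdeg1.
Qed.

Definition hlpow_sym l : symfun {poly K} := to_symfun (hlpow_fam l).

(** The recursion [hlsum2_S] ending in [hlsum2_1]; the parts are [a.+1] and [b.+1]. *)
Fixpoint hlpow2_sym a b : symfun {poly K} :=
  if b is b'.+1 then
    'X *: hlpow2_sym a.+1 b' + hlpow_sym a * hlpow_sym b - hlpow_sym a.+1 * hlpow_sym b'
  else hlpow_sym a * hlpow_sym 0 - hlpow_sym a.+1.

Lemma tofrac_hlpow_sym l N :
  tofrac (hlpow_sym l N) = hlsum (hl_t K N) [:: l.+1] (codom (@hl_x K N)).
Proof.
rewrite hlsum1_hlpow; last exact/injectiveP/hl_x_inj.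
rewrite /hlpow_sym to_symfunE; last exact: hlpow_fam_symfun.
by rewrite /hlpow_fam rmorph_hlpow -map_comp.
Qed.

Lemma tofrac_hlpow2_sym a b N :
  tofrac (hlpow2_sym a b N) = hlsum (hl_t K N) [:: a.+1; b.+1] (codom (@hl_x K N)).
Proof.
have us : uniq (codom (@hl_x K N)) by exact/injectiveP/hl_x_inj.
elim: b a => [|b IH] a.
  by rewrite hlsum2_1 // -!tofrac_hlpow_sym -tofracM -tofracB.
rewrite hlsum2_S // -IH -!tofrac_hlpow_sym -!tofracM -tofracD -tofracB.
by rewrite mul_mpolyC.
Qed.

Lemma is_HL_P_one n : (0 < n)%N -> is_HL_P [:: n] (hlpow_sym n.-1).
Proof.
case: n => // n _ N N1; rewrite tofrac_hlpow_sym HL_frac_uniq //.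
Qed.

Lemma is_HL_P_two a b : (0 < b < a)%N -> is_HL_P [:: a; b] (hlpow2_sym a.-1 b.-1).
Proof.
case: a b => [|a] [|b] // /andP[_ ba] N N2; rewrite tofrac_hlpow2_sym HL_frac_uniq //.
  by rewrite /is_part /= (ltnW ba) ?andbT ?inE.
by rewrite /= inE gtn_eqF.
Qed.

Lemma HL_P_exists la (P : symfun {poly K}) : is_HL_P la P -> is_HL_P la (HL_P K la).
Proof. by move=> HP; rewrite /HL_P; case: xgetP => [// | /(_ P)]. Qed.

(* In all the other cases the theorem predicts [0], which is also what the default value of [HL_P] gives. *)
Lemma part_le2_exists la : is_part la -> (0 < size la <= 2)%N -> odd (sumn la) ->
  is_HL_P la (HL_P K la).
Proof.
move=> /andP[sla la0]; case: la sla la0 => [|a [|b [|c la]]] //= sla la0 _ od.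
  by apply/HL_P_exists/is_HL_P_one; rewrite lt0n; move: la0; rewrite inE eq_sym.
apply/HL_P_exists/is_HL_P_two; move: sla la0; rewrite ?andbT !inE negb_or => ba.
case/andP=> _; rewrite eq_sym -lt0n => -> /=; rewrite ltn_neqAle ba andbT.
(* Two equal parts would have an even sum, so the parts are distinct. *)
by apply: contraTneq od => ->; rewrite addn0 addnn odd_double.
Qed.

Lemma schurQ_one n N : (0 < n)%N -> (0 < N)%N ->
  schurQ K [:: n] N = 2%:R * hlpow (-1) (hl_vars K N) n.-1.
Proof.
move=> n0 N0; have HP := HL_P_exists (is_HL_P_one n0).
have PE : HL_P K [:: n] N = hlpow_fam n.-1 N.
  apply: tofrac_inj; rewrite HP // -(is_HL_P_one n0) //.
  by rewrite /hlpow_sym to_symfunE //; exact: hlpow_fam_symfun.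
have pn : is_part [:: n] by rewrite /is_part /= inE eq_sym -lt0n.
rewrite /schurQ /HL_Q -/(hl_b K [:: n]) hl_b_uniq // expr1.
have -> : symfun_map (horner_eval (-1)) ((1 - 'X) *: HL_P K [:: n]) N =
  map_mpoly (horner_eval (-1)) ((1 - 'X) *: HL_P K [:: n] N) by [].
rewrite PE map_mpolyZ -mul_mpolyC /= /hlpow_fam; congr (_ * _).
  by rewrite /horner_eval !hornerE opprK mpolyCD.
have hX : horner_eval (-1) 'X = -1 :> K by rewrite /horner_eval hornerX.
rewrite rmorph_hlpow /= map_mpolyC /= hX mpolyCN -map_comp; congr hlpow.
by apply: eq_map => i /=; rewrite map_mpolyX.
Qed.

End Existence.

(** * The Hall product with a power sum *)

Definition nonzeros (s : seq nat) := [seq k <- s | k != 0%N].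

Lemma perm_nonzeros s : perm_eq s (nonzeros s ++ nseq (size s - size (nonzeros s)) 0%N).
Proof.
have [s0 sN] : all (pred1 0%N) [seq k <- s | ~~ (k != 0%N)] /\
    (size (nonzeros s) + size [seq k <- s | ~~ (k != 0%N)])%N = size s.
  rewrite !size_filter count_predC; split=> //.
  by apply/allP => k; rewrite mem_filter negbK => /andP[].
rewrite perm_sym -sN addKn -(all_pred1P _ _ s0).
by rewrite perm_filterC.
Qed.

Lemma perm_nonzerosE s1 s2 : size s1 = size s2 ->
  perm_eq (nonzeros s1) (nonzeros s2) -> perm_eq s1 s2.
Proof.
move=> s12 P; rewrite (permPl (perm_nonzeros s1)) perm_sym (permPl (perm_nonzeros s2)).
by rewrite s12 (perm_size P) perm_cat2r perm_sym.
Qed.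

Definition pad n (s : seq nat) : 'X_{1..n} := [multinom nth 0%N s i | i < n].

Lemma padE n s : pad n s = mkseq (nth 0%N s) n :> seq nat.
Proof.
apply: (@eq_from_nth _ 0%N); first by rewrite size_tuple size_mkseq.
move=> i; rewrite size_tuple => i_n; rewrite nth_mkseq //.
by rewrite -[i]/(nat_of_ord (Ordinal i_n)) -mnm_nth mnmE.
Qed.

Lemma nonzeros_pad n s : (size s <= n)%N -> nonzeros (pad n s) = nonzeros s.
Proof.
move=> sn; rewrite padE mkseq_nth_nseq // /nonzeros filter_cat.
rewrite [X in _ ++ X](_ : _ = [::]) ?cats0 //.
by apply/eqP; rewrite -size_eq0 size_filter count_nseq mul0n.
Qed.

Lemma pad_id n (m : 'X_{1..n}) : pad n m = m.
Proof. by apply/mnmP => i; rewrite mnmE -mnm_nth. Qed.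

Lemma mdeg_nonzeros n (m : 'X_{1..n}) : mdeg m = sumn (nonzeros m).
Proof.
rewrite mdegE sumnE big_filter [RHS]big_mkcond /=.
by rewrite [RHS](eq_bigr id) => [|[] //]; rewrite big_tuple.
Qed.

(** * Coefficients of symmetric functions and the monomial basis *)

Section SymfunCoef.
Variable R : comNzRingType.
Implicit Types f g : symfun R.

Lemma symfun_coef_pad f N n (m : 'X_{1..N}) : (N <= n)%N ->
  (f n)@_(pad n m) = (f N)@_m.
Proof.
elim: n => [|n IH]; first by case: N m => // m _; rewrite pad_id.
rewrite leq_eqVlt => /orP[/eqP EN|]; first by subst N; rewrite pad_id.
rewrite ltnS => Nn; rewrite -IH //.
have [_ lf _] := symfun_is f.
rewrite -[f n]/(symfun_val f n) -lf mcoeff_last_zero; congr (mcoeff _ _).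
apply/mnmP => i; case: (unliftP ord_max i) => [j ->|->]; last first.
  by rewrite mnmwiden_ordmax mnmE nth_default // size_tuple.
have -> : lift ord_max j = widen_ord (leqnSn n) j.
  by apply: val_inj; rewrite /= /bump leqNgt ltn_ord.
by rewrite mnmwiden_widen !mnmE.
Qed.

(** Stability pads both monomials to a common number of variables, where symmetry carries one to the
    other. *)
Lemma symfun_coef f N M (m : 'X_{1..N}) (m' : 'X_{1..M}) :
  perm_eq (nonzeros m) (nonzeros m') -> (f N)@_m = (f M)@_m'.
Proof.
move=> P; rewrite -(symfun_coef_pad f m (leq_maxl N M)) -(symfun_coef_pad f m' (leq_maxr N M)).
move: (maxn N M) (leq_maxl N M) (leq_maxr N M) => n Nn Mn.
have [sf _ _] := symfun_is f.
have /tuple_permP[s sE] : perm_eq (pad n m) (pad n m').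
  apply: perm_nonzerosE; first by rewrite !size_tuple.
  by rewrite !nonzeros_pad ?size_tuple.
have fs : msym s (f n) = f n := issymP _ (sf n) s.
rewrite -[in RHS]fs mcoeff_sym; congr (mcoeff _ _).
apply: val_inj; apply: val_inj; rewrite [LHS]sE; apply: (congr1 val).
by apply: eq_from_tnth => i; rewrite !tnth_mktuple.
Qed.

Lemma symfun_ext f g : (forall N, f N = g N) -> f = g.
Proof. by move=> fg; apply: val_inj; apply: functional_extensionality_dep. Qed.

Lemma symfun_ext_large f g M : (forall N, (M <= N)%N -> f N = g N) -> f = g.
Proof.
move=> fg; apply: symfun_ext => N; apply/mpolyP => m.
have NM := leq_maxl N M.
by rewrite -(symfun_coef_pad f m NM) -(symfun_coef_pad g m NM) fg // leq_maxr.
Qed.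

Lemma symfun_sumE (I : Type) (r : seq I) (F : I -> symfun R) N :
  (\sum_(i <- r) F i) N = \sum_(i <- r) F i N.
Proof. by apply: (big_morph (fun f : symfun R => f N)). Qed.

Lemma symfun_prodE (I : Type) (r : seq I) (F : I -> symfun R) N :
  (\prod_(i <- r) F i) N = \prod_(i <- r) F i N.
Proof. by apply: (big_morph (fun f : symfun R => f N)). Qed.

Lemma mcoeff_msum mu N (m : 'X_{1..N}) :
  (msum R mu N)@_m = (perm_eq (nonzeros m) mu)%:R.
Proof.
rewrite msumE raddf_sum /=; have [Pm|nPm] := boolP (perm_eq _ _).
  have dm : (mdeg m < (sumn mu).+1)%N by rewrite ltnS mdeg_nonzeros (perm_sumn Pm).
  rewrite (bigD1 (BMultinom dm)) //= mcoeffX eqxx big1 ?addr0 //.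
  move=> k /andP[_ kN]; rewrite mcoeffX; case: eqP => // kE.
  by case/eqP: kN; apply: val_inj.
rewrite big1 // => k Pk; rewrite mcoeffX; case: eqP => // kE.
by case/negP: nPm; rewrite -kE.
Qed.

Definition shomog n f := forall N, f N \is n.-homog.

Lemma shomog_coef n f N m : shomog n f -> mdeg m != n -> (f N)@_m = 0.
Proof.
move=> fn; apply: contraNeq; rewrite -mcoeff_msupp => mf.
by apply/eqP; move/dhomogP: (fn N) => /(_ m mf).
Qed.

Lemma shomog_hsum k : shomog k (hsum R k).
Proof.
move=> N; rewrite hsumE; apply: rpred_sum => m /eqP mk.
by rewrite dhomogX; apply/eqP.
Qed.

Lemma shomog_hsum_part la : shomog (sumn la) (hsum_part R la).
Proof.
move=> N; rewrite /hsum_part symfun_prodE.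
elim: la => [|k la IH]; first by rewrite big_nil dhomog1.
by rewrite big_cons; apply: dhomogM IH; exact: shomog_hsum.
Qed.

Lemma shomog_psum n : (0 < n)%N -> shomog n (psum R n).
Proof.
move=> n0 N; rewrite psumE //; apply: rpred_sum => i _.
by rewrite mpolyXn dhomogX /= mdegMn mdeg1 mul1n.
Qed.

Lemma size_part (la : seq nat) : 0%N \notin la -> (size la <= sumn la)%N.
Proof.
elim: la => //= k la IH; rewrite inE negb_or eq_sym -lt0n => /andP[k0 /IH].
by lia.
Qed.

Definition parts n : seq (seq nat) :=
  undup [seq mu <- flatten [seq [seq map val (val t) | t : k.-tuple 'I_n.+1] | k <- iota 0 n.+1]
    | is_part_of n mu].

Lemma mem_parts n mu : (mu \in parts n) = is_part_of n mu.
Proof.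
rewrite mem_undup mem_filter; case: (boolP (is_part_of n mu)) => // /andP[/andP[_ mu0] /eqP mun].
rewrite andTb.
apply/flattenP; exists [seq map val (val t) | t : (size mu).-tuple 'I_n.+1].
  by apply/mapP; exists (size mu) => //; rewrite mem_iota add0n ltnS -mun size_part.
apply/mapP; exists [tuple of map (@inord n) (in_tuple mu)]; first by rewrite mem_enum.
rewrite /= -map_comp map_id_in // => k kmu /=.
by rewrite inordK // ltnS -mun leq_part_sumn.
Qed.

Lemma parts_uniq n : uniq (parts n).
Proof. exact: undup_uniq. Qed.

Lemma perm_part_eq mu nu : is_part mu -> is_part nu -> perm_eq mu nu -> mu = nu.
Proof.
move=> /andP[smu _] /andP[snu _]; apply: (sorted_eq _ _ smu snu).
- by move=> a b c /= ba ac; apply: leq_trans ac ba.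
- by move=> a b /andP[ab ba]; apply/eqP; rewrite eqn_leq; apply/andP; split.
Qed.

Lemma nonzeros_part mu : is_part mu -> nonzeros mu = mu.
Proof. by case/andP=> _ mu0; apply/all_filterP/allP => k kmu; apply: contraNneq mu0 => <-. Qed.

Lemma msum_expansion n f : shomog n f ->
  f = \sum_(mu <- parts n) (f n)@_(pad n mu) *: msum R mu.
Proof.
move=> fn; apply: symfun_ext => N; apply/mpolyP => m.
rewrite symfun_sumE raddf_sum /=.
have -> : \sum_(mu <- parts n) (((f n)@_(pad n mu) *: msum R mu) N)@_m =
   \sum_(mu <- parts n) (f n)@_(pad n mu) * (perm_eq (nonzeros m) mu)%:R.
  by apply: eq_bigr => mu _; rewrite -mcoeff_msum -mcoeffZ.
have [mn|mn] := eqVneq (mdeg m) n; last first.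
  rewrite (shomog_coef fn mn) big1_seq // => mu /andP[_]; rewrite mem_parts => /andP[_ /eqP mun].
  case: (boolP (perm_eq _ _)) => [/perm_sumn|]; last by rewrite mulr0.
  by rewrite -mdeg_nonzeros mun => /eqP; rewrite (negPf mn).
(* The only partition whose monomial function contains the monomial [m]. *)
pose mu0 := sort geq (nonzeros m).
have P0 : perm_eq mu0 (nonzeros m) by rewrite perm_sort.
have p0 : is_part_of n mu0.
  rewrite /is_part_of (perm_sumn P0) -mdeg_nonzeros mn eqxx andbT /is_part.
  rewrite sort_sorted => [|a b]; last exact: leq_total.
  by rewrite (perm_mem P0) mem_filter.
have /andP[pp0 /eqP s0] := p0.
have mu0P : mu0 \in parts n by rewrite mem_parts.
rewrite (bigD1_seq mu0 mu0P (parts_uniq n)) /= [perm_eq _ mu0]perm_sym P0 mulr1.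
rewrite big1_seq ?addr0 => [|mu /andP[mumu0]]; last first.
  rewrite mem_parts => /andP[pmu _].
  case: (boolP (perm_eq _ _)) => [Pm|]; last by rewrite mulr0.
  by case/eqP: mumu0; apply: perm_part_eq; rewrite // perm_sym (permPl P0).
have mu0n : (size mu0 <= n)%N by rewrite -s0 size_part //; case/andP: pp0.
by apply: symfun_coef; rewrite nonzeros_pad // (nonzeros_part pp0) perm_sym.
Qed.

End SymfunCoef.

(** * Pairing with a power sum compared with evaluation at the roots of unity *)

Section HallProduct.
Variables (K : fieldType) (hall : {biscalar symfun K}).
Hypothesis hallP : is_hall_product hall.

(* Duality makes the [h_la] independent; since there are as many of them as [m_mu], they span. *)
Lemma hsum_expansion n (f : symfun K) : shomog n f ->
  exists c : seq nat -> K, f = \sum_(la <- parts n) c la *: hsum_part K la.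
Proof.
move=> fn; pose d := size (parts n); pose S (i : 'I_d) := nth [::] (parts n) i.
have Spart i : is_part_of n (S i) by rewrite -mem_parts mem_nth.
have sumE (V : nmodType) (G : seq nat -> V) : \sum_(mu <- parts n) G mu = \sum_(i < d) G (S i).
  by rewrite (big_nth [::]) big_mkord.
pose M := \matrix_(i < d, j < d) (hsum_part K (S i) n)@_(pad n (S j)).
pose G := \matrix_(i < d, j < d) hall (msum K (S i)) (msum K (S j)).
have hM i : hsum_part K (S i) = \sum_(j < d) M i j *: msum K (S j).
  have hn : shomog n (hsum_part K (S i)).
    by have /andP[_ /eqP {1}<-] := Spart i; exact: shomog_hsum_part.
  by rewrite {1}(msum_expansion hn) sumE; apply: eq_bigr => j _; rewrite mxE.
have MG : M *m G = 1%:M.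
  apply/matrixP => i k; rewrite !mxE.
  have -> : (i == k) = (S i == S k) by rewrite nth_uniq ?parts_uniq.
  have /andP[pi _] := Spart i; have /andP[pk _] := Spart k.
  rewrite -hallP // (hM i) linear_sumlz; apply: eq_bigr => j _.
  by rewrite [in RHS]linearZl_LR [G _ _]mxE.
(* A one-sided inverse of a square matrix is two-sided, so the Gram matrix of the [msum] is the
   transition matrix back to the [hsum_part]. *)
have mG i : msum K (S i) = \sum_(j < d) G i j *: hsum_part K (S j).
  under eq_bigr do rewrite hM scaler_sumr.
  rewrite exchange_big /=.
  under eq_bigr => k _.
    under eq_bigr do rewrite scalerA.
    rewrite -scaler_suml (_ : \sum_(j < d) G i j * M j k = (i == k)%:R); last first.
      by have /matrixP/(_ i k) := mulmx1C MG; rewrite !mxE.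
    over.
  by rewrite (bigD1 i) //= eqxx scale1r big1 ?addr0 // => k; rewrite eq_sym => /negPf ->; rewrite scale0r.
pose a i := (f n)@_(pad n (S i)).
exists (fun la => \sum_(i < d | true) a i * hall (msum K (S i)) (msum K la)).
rewrite {1}(msum_expansion fn) !sumE -/(a _).
under eq_bigr => i _ do rewrite mG scaler_sumr.
rewrite exchange_big /=; apply: eq_bigr => j _; rewrite scaler_suml.
by apply: eq_bigr => i _; rewrite scalerA mxE.
Qed.

Lemma hall_hsum_psum n la : (0 < n)%N -> is_part_of n la ->
  hall (hsum_part K la) (psum K n) = (psum K n n)@_(pad n la).
Proof.
move=> n0 pla; rewrite {1}(msum_expansion (shomog_psum K n0)) linear_sumr.
have /andP[pp _] := pla.
rewrite (bigD1_seq la) ?parts_uniq ?mem_parts //= linearZr_LR hallP // eqxx mulr1.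
rewrite big1_seq ?addr0 // => mu /andP[mula]; rewrite mem_parts => /andP[pmu _].
by rewrite linearZr_LR hallP // eq_sym (negPf mula) mulr0.
Qed.

Lemma psum_coef_neq n la : (0 < n)%N -> is_part_of n la -> la != [:: n] ->
  (psum K n n)@_(pad n la) = 0.
Proof.
move=> n0 /andP[/andP[_ la0] /eqP lan] laN; rewrite psumE // raddf_sum big1 // => i _ /=.
rewrite mcoeffXn; case: eqP => // /mnmP padE'.
case: la la0 lan laN padE' => [|k la]; first by move=> _ nE; exfalso; move: n0; rewrite -nE.
rewrite inE negb_or eq_sym -lt0n => /andP[k0 la0] lan laN padE'.
have := padE' (Ordinal n0); rewrite mnmE mulmnE mnmE /= => kE.
have kn : k = n by move: kE; case: eqP => [_|_] /=; rewrite ?mul1n ?mul0n // => k00; rewrite -k00 in k0.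
case/negP: laN; move: lan; rewrite /= kn => /eqP; rewrite -{2}[n]addn0 eqn_add2l => /eqP s0.
by move: (size_part la0); rewrite s0 leqn0 size_eq0 => /eqP ->.
Qed.

Variables (L : fieldType) (phi : {rmorphism K -> L}) (n : nat) (zeta : L).
Hypotheses (charL : [pchar L] =i pred0) (zetaP : n.-primitive_root zeta).

Let n_gt0 : (0 < n)%N := prim_order_gt0 zetaP.

Definition at_unity (f : symfun K) : L := mmap phi (fun i : 'I_n => zeta ^+ i) (f n).

Lemma mmap_msym N (y : 'I_N -> L) (s : 'S_N) (p : {mpoly K[N]}) :
  mmap phi y (msym s p) = mmap phi (y \o s) p.
Proof.
rewrite [p in LHS]mpolyE (raddf_sum (msym s)) (raddf_sum (mmap phi y)) /= [in RHS]/mmap. apply: eq_bigr => m _.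
rewrite linearZ /= mmapZ; congr (_ * _).
rewrite msymX mmapX /mmap1 [LHS](reindex_inj (@perm_inj _ s)).
by apply: eq_bigr => i _; rewrite mnmE permK.
Qed.

Lemma mmap_scale N (y : 'I_N -> L) c k (p : {mpoly K[N]}) : p \is k.-homog ->
  mmap phi (fun i => c * y i) p = c ^+ k * mmap phi y p.
Proof.
move=> /dhomogP pk; rewrite /mmap mulr_sumr !big_seq; apply: eq_bigr => m mp.
have <- : mdeg m = k := pk m mp.
rewrite mulrCA; congr (_ * _); rewrite /mmap1 mdegE -prodrXr -big_split.
by apply: eq_bigr => i _; rewrite exprMn.
Qed.

(** Multiplication by [zeta] permutes the points cyclically, so by symmetry and homogeneity the
    value is fixed by the factor [zeta ^+ k], which is not 1. *)
Lemma at_unity_hsum k : (0 < k < n)%N -> at_unity (hsum K k) = 0.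
Proof.
move=> /andP[k0 kn]; have [sf _ _] := symfun_is (hsum K k).
pose s : 'S_n := perm (@ordS_inj n).
have : zeta ^+ k * at_unity (hsum K k) = at_unity (hsum K k).
  have hs : msym s (hsum K k n) = hsum K k n := issymP _ (sf n) s.
  rewrite /at_unity -(mmap_scale _ _ (shomog_hsum K k n)) -[in RHS]hs mmap_msym; apply: eq_bigr => m _.
  congr (_ * _); apply: eq_bigr => i _; congr (_ ^+ _).
  by rewrite /= permE /= prim_expr_mod // exprS.
move/eqP; rewrite -subr_eq0 -{2}[at_unity _]mul1r -mulrBl mulf_eq0 subr_eq0.
by rewrite -(prim_order_dvd zetaP) gtnNdvd //= => /eqP.
Qed.

Lemma at_unity_hsum_part la : is_part_of n la -> la != [:: n] ->
  at_unity (hsum_part K la) = 0.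
Proof.
move=> /andP[/andP[_ la0] /eqP lan] laN.
rewrite /at_unity /hsum_part symfun_prodE rmorph_prod.
apply/eqP; rewrite prodf_seq_eq0; apply/hasP.
case: la la0 lan laN => [|k [|l la]]; first by move=> _ nE; exfalso; move: n_gt0; rewrite -nE.
  by rewrite /= addn0 => _ ->; rewrite eqxx.
rewrite !inE !negb_or 2!(eq_sym 0%N) -!lt0n => /and3P[k0 l0 _] /= lan _.
exists k; rewrite ?inE ?eqxx //=; apply/eqP/at_unity_hsum; rewrite k0 /= -lan.
by rewrite -[ltnLHS]addn0 ltn_add2l addn_gt0 l0.
Qed.

Lemma at_unity_psum : at_unity (psum K n) != 0.
Proof.
rewrite /at_unity psumE // rmorph_sum /=.
under eq_bigr => i _ do rewrite rmorphXn /= mmapX mmap1U -exprM mulnC exprM (prim_expr_order zetaP) expr1n.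
by rewrite sumr_const card_ord ((pcharf0P _).1 charL) -lt0n.
Qed.

Lemma at_unityZ a (f : symfun K) : at_unity (a *: f) = phi a * at_unity f.
Proof. exact: mmapZ. Qed.

Lemma at_unity_sum (I : Type) (r : seq I) (F : I -> symfun K) :
  at_unity (\sum_(i <- r) F i) = \sum_(i <- r) at_unity (F i).
Proof. by rewrite /at_unity symfun_sumE raddf_sum. Qed.

(** Both functionals vanish on every [hsum_part] except the one of [[:: n]], so each is a constant
    times the coefficient there. Testing on [psum K n] shows that neither constant is zero. *)
Lemma hall_psum_neq0 (f : symfun K) : shomog n f ->
  (hall f (psum K n) != 0) = (at_unity f != 0).
Proof.
move=> fn.
have pn : is_part_of n [:: n] by rewrite /is_part_of /is_part /= inE eq_sym -lt0n n_gt0 addn0 eqxx.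
pose a := (psum K n n)@_(pad n [:: n]); pose kappa := at_unity (hsum_part K [:: n]).
have key (g : symfun K) : shomog n g -> exists c : K,
    hall g (psum K n) = c * a /\ at_unity g = phi c * kappa.
  move=> /hsum_expansion[c ->]; exists (c [:: n]); split.
    rewrite linear_sumlz (bigD1_seq [:: n]) ?parts_uniq ?mem_parts //= linearZl_LR /=.
    rewrite hall_hsum_psum // big1_seq ?addr0 // => mu /andP[muN]; rewrite mem_parts => pmu.
    by rewrite linearZl_LR /= hall_hsum_psum // psum_coef_neq // mulr0.
  rewrite at_unity_sum (bigD1_seq [:: n]) ?parts_uniq ?mem_parts //= at_unityZ.
  rewrite big1_seq ?addr0 // => mu /andP[muN]; rewrite mem_parts => pmu.
  by rewrite at_unityZ at_unity_hsum_part // mulr0.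
have kappa0 : kappa != 0.
  have [c [_ E]] := key _ (shomog_psum K n_gt0).
  by move: at_unity_psum; rewrite E mulf_eq0 negb_or => /andP[].
(* Otherwise all monomial coefficients of [psum K n] would vanish, against its nonzero value at the
   roots of unity. *)
have a0 : a != 0.
  apply: contraNneq at_unity_psum => a0.
  rewrite (msum_expansion (shomog_psum K n_gt0)) big1_seq ?/at_unity ?raddf0 //.
  move=> mu /andP[_]; rewrite mem_parts => pmu.
  have [->|muN] := eqVneq mu [:: n]; first by rewrite -/a a0 scale0r.
  by rewrite psum_coef_neq // scale0r.
have [c [-> ->]] := key f fn.
by rewrite !mulf_eq0 (negPf a0) (negPf kappa0) !orbF fmorph_eq0.
Qed.

End HallProduct.

(** * The theorem *)

Lemma irreducible_factor (K : fieldType) (p : {poly K}) : (1 < size p)%N ->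
  exists2 q, irreducible_poly q & q %| p.
Proof.
have [m] := ubnP (size p); elim: m p => // m IH p pm p1.
have p0 : p != 0 by rewrite -size_poly_gt0 ltnW.
have [irr|] := pselect (forall q : {poly K}, size q != 1%N -> q %| p -> q %= p); first by exists p.
move=> /existsNP[q /not_implyP[q1 /not_implyP[qp nqp]]].
have q0 : q != 0 by apply: contraNneq p0 => q0; rewrite q0 dvd0p in qp.
have sqp : (size q < size p)%N.
  rewrite ltn_neqAle dvdp_leq // andbT; apply/negP => /eqP sE.
  by apply: nqp; rewrite -(dvdp_size_eqp qp) sE.
have [||r irr rq] := IH q; first exact: leq_trans sqp _.
  by rewrite ltn_neqAle eq_sym q1 size_poly_gt0.
by exists r => //; apply: dvdp_trans rq qp.
Qed.

(** Adjoining a root of an irreducible factor leaves a cofactor of smaller degree over a larger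
    field, so the induction generalizes over the field. *)
Lemma exists_splitting (K : fieldType) (p : {poly K}) : p != 0 ->
  exists (L : fieldType) (phi : {rmorphism K -> L}) (rs : seq L),
    map_poly phi p %= \prod_(x <- rs) ('X - x%:P).
Proof.
have [m] := ubnP (size p); elim: m K p => // m IH K p pm p0.
have [p1|p1] := leqP (size p) 1.
  exists K, idfun, [::]; rewrite big_nil map_poly_id // -size_poly_eq1.
  by rewrite eqn_leq p1 size_poly_gt0.
have [q irr qp] := irreducible_factor p1.
have [L _ [z zq _]] := irredp_FAdjoin irr.
have zp : root (map_poly (in_alg L) p) z.
  by move: zq; rewrite -!dvdp_XsubCl => /dvdp_trans; apply; rewrite dvdp_map.
have [r rE] := factor_theorem _ _ zp.
have r0 : r != 0.
  by apply: contraNneq p0 => r0; rewrite -(map_poly_eq0 (in_alg L)) rE r0 mul0r.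
have sr : (size r < m)%N.
  have := congr1 (fun f : {poly L} => size f) rE.
  by rewrite /= size_map_poly size_Mmonic ?monicXsubC // size_XsubC addn2 /= => sE; rewrite sE in pm.
have [M [phi [rs rsE]]] := IH _ _ sr r0.
exists M, (phi \o in_alg L), (phi z :: rs).
rewrite map_poly_comp rE rmorphM /= rmorphB /= map_polyX map_polyC /= big_cons mulrC.
by rewrite eqp_mull.
Qed.

(** As [n] is invertible, ['X^n - 1] is separable; its [n] distinct roots in a splitting field
    include a primitive one. *)
Lemma exists_prim_root (K : fieldType) n : [pchar K] =i pred0 -> (0 < n)%N ->
  exists (L : fieldType) (_ : {rmorphism K -> L}) (zeta : L), n.-primitive_root zeta.
Proof.
move=> charK n0.
have [|L [phi [rs rsE]]] := @exists_splitting K ('X^n - 1).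
  by rewrite -size_poly_gt0 size_Xn_sub_1.
rewrite rmorphB /= map_polyXn rmorph1 in rsE.
have {rsE} rsE : 'X^n - 1 = \prod_(x <- rs) ('X - x%:P) :> {poly L}.
  by apply/eqP; rewrite -eqp_monic ?monic_Xn_sub_1 ?monic_prod_XsubC.
have nL : n%:R != 0 :> L by rewrite -(rmorph_nat phi) fmorph_eq0 ((pcharf0P _).1 charK) -lt0n.
have : has n.-primitive_root rs.
  apply: has_prim_root => //.
  - apply/allP => x xrs; rewrite unity_rootE -subr_eq0.
    have : root ('X^n - 1) x by rewrite rsE root_prod_XsubC.
    by rewrite rootE !hornerE.
  - by rewrite -separable_prod_XsubC -rsE separable_Xn_sub_1.
  - have := congr1 (fun f : {poly L} => size f) rsE.
    by rewrite size_Xn_sub_1 // size_prod_XsubC => -[->].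
by case/hasP=> zeta _ zetaP; exists L, phi, zeta.
Qed.

Lemma codom_unity (L : fieldType) n (zeta : L) :
  codom (fun i : 'I_n => zeta ^+ i) = unity n zeta.
Proof. by rewrite /unity -val_enum_ord -map_comp. Qed.

Lemma schurQ_shomog (K : fieldType) la : [pchar K] =i pred0 ->
  is_HL_P la (HL_P K la) -> is_part la -> shomog (sumn la) (schurQ K la).
Proof.
move=> charK HP pla N; apply/dhomogP => m /=; rewrite mcoeff_msupp.
(* [HL_Q_homog] requires at least [size la] variables, so the monomial is padded. *)
rewrite -(symfun_coef_pad (schurQ K la) m (leq_maxl N (size la))) => H.
have -> : mdeg m = mdeg (pad (maxn N (size la)) m).
  by rewrite !mdeg_nonzeros nonzeros_pad // size_tuple leq_maxl.
apply: (HL_Q_homog charK HP pla (leq_maxr N (size la))).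
apply: contraNneq H => H; apply/eqP.
have -> : (schurQ K la (maxn N (size la)))@_(pad (maxn N (size la)) m) =
    horner_eval (-1) (HL_Q K la (maxn N (size la)))@_(pad (maxn N (size la)) m).
  exact: mcoeff_map_mpoly.
by rewrite H /horner_eval horner0.
Qed.

Lemma hall_schurQ_psum (K : fieldType) (hall : {biscalar symfun K}) la :
  [pchar K] =i pred0 -> is_hall_product hall -> is_part la -> (0 < sumn la)%N ->
  is_HL_P la (HL_P K la) ->
  (hall (schurQ K la) (psum K (sumn la)) != 0) = odd (sumn la) && (size la <= 2)%N.
Proof.
move=> charK hallP pla n0 HP; have /andP[_ la0] := pla.
have [L [phi [zeta zetaP]]] := exists_prim_root charK n0.
have charL : [pchar L] =i pred0 by move=> q; rewrite (fmorph_pchar phi) charK.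
rewrite (hall_psum_neq0 hallP phi charL zetaP (schurQ_shomog charK HP pla)).
have y_inj : injective (fun i : 'I_(sumn la) => zeta ^+ i).
  move=> i j /eqP; rewrite (eq_prim_root_expr zetaP) !modn_small // => /eqP.
  exact: val_inj.
rewrite /at_unity mmap_schurQ ?size_part // codom_unity.
rewrite mulf_eq0 negb_or expf_neq0 ?((pcharf0P _).1 charL) //=.
case: la {HP y_inj} pla n0 la0 zetaP => // l la _ n0.
rewrite inE negb_or eq_sym -lt0n => /andP[l0 la0] zetaP.
have [od|ev] := boolP (odd _); last by rewrite hlsum_unity_even ?eqxx.
rewrite (hlsum_unity charL zetaP od l0 la0) //= ltnS.
by case: ifP => _; rewrite ?eqxx // expf_neq0 // oppr_eq0 oner_eq0.
Qed.

(** * Algebraic dependence in degrees 1 and 2 *)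

Section Dependence.
Variables (K : fieldType) (A : comAlgType K).

Lemma alg_dependent_sub (S T : set A) : (S `<=` T)%classic -> alg_dependent S -> alg_dependent T.
Proof. by move=> ST [k [s [P [s_inj sS P0 sP]]]]; exists k, s, P; split=> // i; apply: ST. Qed.

Lemma alg_dependent0 (S : set A) : S 0 -> alg_dependent S.
Proof.
move=> S0; exists 1%N, (fun=> 0), 'X_ord0; split=> //.
- by move=> i j _; rewrite !ord1.
- by apply/eqP => /(congr1 (mcoeff U_(ord0)%MM)) /eqP; rewrite mcoeffX eqxx mcoeff0 oner_eq0.
- by rewrite mmapX mmap1U.
Qed.

Lemma alg_dependent_sqr (S : set A) a b : S a -> S b -> a ^+ 2 = b *+ 2 -> alg_dependent S.
Proof.
move=> Sa Sb ab.
have U2 m (i j : 'I_m) : U_(i)%MM != (U_(j) *+ 2)%MM.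
  by apply/eqP => /(congr1 mdeg); rewrite mdegMn !mdeg1.
(* Dependence is witnessed by an injective family, so equal elements call for a relation in one
   variable. *)
have [ab'|ab'] := eqVneq a b.
  exists 1%N, (fun=> a), ('X_ord0 ^+ 2 - 'X_ord0 *+ 2); split=> //.
  - by move=> i j _; rewrite !ord1.
  - apply/eqP => /(congr1 (mcoeff (U_(ord0) *+ 2)%MM)) /eqP.
    rewrite mcoeffB mcoeffMn mcoeffXn eqxx mcoeffX mcoeff0.
    by rewrite (negPf (U2 _ _ _)) mul0rn subr0 oner_eq0.
  - by rewrite rmorphB rmorphXn rmorphMn /= mmapX mmap1U ab ab' subrr.
exists 2%N, (fun i : 'I_2 => if i == ord0 then a else b), ('X_ord0 ^+ 2 - 'X_ord_max *+ 2); split.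
- move=> [[|[|i]] hi] // [[|[|j]] hj] //= E; apply: val_inj => //=.
    by rewrite E eqxx in ab'.
  by rewrite E eqxx in ab'.
- by move=> i; case: ifP.
- apply/eqP => /(congr1 (mcoeff (U_(ord0) *+ 2)%MM)) /eqP.
  rewrite mcoeffB mcoeffMn mcoeffXn eqxx mcoeffX mcoeff0.
  by rewrite (negPf (U2 _ _ _)) mul0rn subr0 oner_eq0.
- by rewrite rmorphB rmorphXn rmorphMn /= !mmapX !mmap1U /= ab subrr.
Qed.

End Dependence.

(** The repeated part puts the factor [1 - 'X ^+ 2] into the normalization, and it vanishes at -1
    whatever the value of [HL_P]. *)
Lemma schurQ_11 (K : fieldType) : schurQ K [:: 1%N; 1%N] = 0.
Proof.
apply: symfun_ext => N; rewrite /schurQ /HL_Q -/(hl_b K _).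
rewrite -[LHS]/(map_mpoly (horner_eval (-1)) (hl_b K [:: 1%N; 1%N] *: HL_P K [:: 1%N; 1%N] N)).
rewrite map_mpolyZ /= (_ : horner_eval _ _ = 0) ?scale0r //.
rewrite /horner_eval /hl_b big_ltn // hornerM.
rewrite -[(count_mem 1%N _).+1]/3%N big_ltn // big_ltn // !hornerM !hornerD !hornerN !hornerXn !hornerC.
by rewrite sqrrN expr1n subrr mul0r mulr0 mul0r.
Qed.

Lemma schurQ_sqr (K : fieldType) : schurQ K [:: 1%N] ^+ 2 = schurQ K [:: 2%N] *+ 2.
Proof.
apply: (@symfun_ext_large _ _ _ 1) => N N1.
rewrite expr2 mulr2n -[LHS]/(schurQ K [:: 1%N] N * schurQ K [:: 1%N] N).
rewrite -[RHS]/(schurQ K [:: 2%N] N + schurQ K [:: 2%N] N).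
by rewrite !schurQ_one // hlpow_sqr; ring.
Qed.

Theorem theorem4p10 (K : fieldType) (charK0 : [pchar K] =i pred0) :
  (forall (hall : {biscalar symfun K}), is_hall_product hall ->
   forall (n : nat) (la : seq nat), (1 <= n)%N -> is_part_of n la ->
     (hall (schurQ K la) (psum K n) != 0 <->
        odd n /\ (2 > size la - 1)%N)) /\
  (forall lambda : nat -> seq nat, (forall n, is_part_of n (lambda n)) ->
     let u n := schurQ K (lambda n) in
     alg_dependent (range u) /\
     alg_dependent [set u n | n in [set n | (1 <= n)%N]]%classic).
Proof.
split=> [hall hallP n la n0 /andP[pla /eqP lan]|lambda lambdaP u].
  subst n; have la_gt0 : (0 < size la)%N by case: la n0 {pla}.
  have -> : (2 > size la - 1)%N = (size la <= 2)%N by lia.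
  suff -> : (hall (schurQ K la) (psum K (sumn la)) != 0) = odd (sumn la) && (size la <= 2)%N.
    by split=> /andP.
  have [/andP[od s2]|small] := boolP (odd (sumn la) && (size la <= 2)%N).
    rewrite hall_schurQ_psum ?od //.
    by apply: part_le2_exists => //; rewrite la_gt0.
  (* The pairing is to be zero here, which the default value of [HL_P] also gives. *)
  have [P0|HP] := HL_P_is K la; last by rewrite hall_schurQ_psum // (negPf small).
  by rewrite schurQ0 // linear0l eqxx.
have U n : (0 < n)%N -> [set u n | n in [set n | (1 <= n)%N]]%classic (u n) by exists n.
have D : alg_dependent [set u n | n in [set n | (1 <= n)%N]]%classic.
  have l1 : lambda 1%N = [:: 1%N].
    have /andP[/andP[_]] := lambdaP 1%N; case: (lambda 1%N) => [|[|[|k]] [|[|l] s]] //=.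
  have [l2|l2] : lambda 2%N = [:: 2%N] \/ lambda 2%N = [:: 1%N; 1%N].
    have /andP[/andP[_ l0] /eqP ls] := lambdaP 2%N.
    case: (lambda 2%N) l0 ls => [|a [|b [|c s]]] //=; rewrite !inE ?negb_or => l0 ls.
    - by left; congr [:: _]; lia.
    - by right; congr [:: _; _]; lia.
    - by exfalso; lia.
  - apply: (alg_dependent_sqr (U 1%N isT) (U 2%N isT)).
    by rewrite /u l1 l2 schurQ_sqr.
  - apply: alg_dependent0; have := U 2%N isT; by rewrite {2}/u l2 schurQ_11.
split=> //; apply: alg_dependent_sub D => _ [n _ <-].
by exists n.
Qed.
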